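(* Let $X$ be a Polish space, $\rho$ an infinite, diffuse, locally finite measure on $X$, $(Y_t)_{0\le t<1}$ the spatial Chinese restaurant-like process with parameter $\rho$, and $(B_n)_n$ an increasing sequence of bounded measurable sets with $\bigcup_nB_n=X$ and $\rho(B_n)>0$. Put $V_{B_n,t}=U_{B_n}(Y_t)/\rho(B_n)$. Then almost surely, simultaneously for all $t\in[0,1)$, $$\lim_{n\to\infty}V_{B_n,t}=\sum_{j\ge1}\frac{t^j}{j}\,\delta_j$$ in the vague topology of measures on $\mathbb N$.
   Context: $\mathbb N=\{1,2,\dots\}$. $X$ is a Polish space with its bounded Borel sets; $\mathcal M(X)$ is the space of locally finite measures (finite on bounded sets) with the vague topology, $\mathcal M^{\cdot\cdot}(X)$ its closed subset of point measures. Vague convergence of measures on the discrete space $\mathbb N$ is convergence of the weight at each $j\in\mathbb N$. Pólya sum process: for $z\in[0,1)$ and $\kappa\in\mathcal M(X)$, $\mathsf S_{z,\kappa}$ denotes the unique law on $\mathcal M^{\cdot\cdot}(X)$ satisfying, for all measurable $h\ge 0$, $\iint h(x,\mu)\,\mu(\mathrm dx)\,\mathsf S_{z,\kappa}(\mathrm d\mu)=\iint h(x,\mu+\delta_x)\,z(\kappa+\mu)(\mathrm dx)\,\mathsf S_{z,\kappa}(\mathrm d\mu)$. Spatial Chinese restaurant-like process with parameter $\rho\in\mathcal M(X)$: the Markov process $(Y_t)_{0\le t<1}$ with values in $\mathcal M^{\cdot\cdot}(X)$ and càdlàg, increasing paths ($Y_s\le Y_t$ for $s\le t$) such that $Y_0=0$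 and, for $0\le s<t<1$, the conditional law of $Y_t-Y_s$ given $Y_s$ is $\mathsf S_{\frac{t-s}{1-s},\,\rho+Y_s}$. For a bounded Borel set $B$ and $\mu\in\mathcal M^{\cdot\cdot}(X)$, $U_B(\mu)$ is the finite point measure on $\mathbb N$ whose weight at $j$ is the number of $x\in B$ with $\mu(\{x\})=j$. *)

(* Defs.v *)
From HB Require Import structures.
From mathcomp Require Import all_boot all_order all_algebra.
From mathcomp Require Import finmap.
From mathcomp Require Import all_classical all_reals all_analysis.
From mathcomp Require Import measurable_realfun.

Set Implicit Arguments.
Unset Strict Implicit.
Unset Printing Implicit Defensive.

Import Order.TTheory GRing.Theory Num.Theory.
Import numFieldNormedType.Exports.

Local Open Scope classical_set_scope.
Local Open Scope ring_scope.

HB.mixin Record isSeparable T & Topological T := {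
  separable_dense : exists2 D : set T, countable D & dense D }.

(* A Polish space comes with a complete metric generating its topology: this
   metric says which sets are bounded. *)
#[short(type="polishType")]
HB.structure Definition Polish (R : numDomainType) :=
  { T of Metric R T & Complete T & isSeparable T }.

Notation borel T := (g_sigma_algebraType (@open T)).

Definition bounded_subset (R : numDomainType) (X : metricType R) (B : set X) :=
  exists (x : X) (r : R), B `<=` ball x r.

Section locally_finite_measures.
Context (R : realType) (X : polishType R).

Record lfmeasure := LFMeasure {
  lf_measure :> {measure set (borel X) -> \bar R} ;
  lf_bounded_lty : forall B : set (borel X),
    measurable B -> bounded_subset B -> (lf_measure B < +oo)%E }.

Lemma lfmeasure_eq (mu nu : lfmeasure) :
  mu = nu :> (set (borel X) -> \bar R) -> mu = nu.
Proof.
case: mu nu => [mu hmu] [nu hnu] /= /eq_measure munu.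
by move: hmu hnu; rewrite munu => hmu hnu; congr LFMeasure; exact: Prop_irrelevance.
Qed.

Lemma lf_zero_subproof (B : set (borel X)) :
  measurable B -> bounded_subset B ->
  ((mzero : {measure set (borel X) -> \bar R}) B < +oo)%E.
Proof. by move=> _ _; rewrite /= /mzero ltry. Qed.

Definition lf_zero := LFMeasure lf_zero_subproof.

Lemma lf_add_subproof (mu nu : lfmeasure) (B : set (borel X)) :
  measurable B -> bounded_subset B ->
  ((measure_add mu nu : {measure set (borel X) -> \bar R}) B < +oo)%E.
Proof.
move=> mB bB; rewrite [X in (X < _)%E](measure_addE mu nu B).
by rewrite lte_add_pinfty// lf_bounded_lty.
Qed.

Definition lf_add (mu nu : lfmeasure) := LFMeasure (@lf_add_subproof mu nu).

HB.instance Definition _ := gen_eqMixin lfmeasure.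
HB.instance Definition _ := gen_choiceMixin lfmeasure.
HB.instance Definition _ := isPointed.Build lfmeasure lf_zero.

Definition vague_test : set (X -> R) :=
  [set f : X -> R | [/\ continuous f, forall x, 0 <= f x,
      exists M, forall x, f x <= M &
      bounded_subset [set x | f x != 0]]].

(* All these integrals are finite, so nothing is lost in using the real-valued
   integral. *)
Definition vague_eval (mu : lfmeasure) :
    prod_topology (fun _ : set_type vague_test => R) :=
  fun f => \int[mu]_x (val f x).

HB.instance Definition _ :=
  Topological.copy lfmeasure (initial_topology vague_eval).

Record pointmeasure := PointMeasure {
  pm_measure :> lfmeasure ;
  pm_integer : forall B : set (borel X), measurable B -> bounded_subset B ->
    exists n : nat, pm_measure B = (n%:R)%:E }.

Lemma pointmeasure_eq (mu nu : pointmeasure) :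
  mu = nu :> (set (borel X) -> \bar R) -> mu = nu.
Proof.
case: mu nu => [mu hmu] [nu hnu] /= /lfmeasure_eq munu.
by move: hmu hnu; rewrite munu => hmu hnu; congr PointMeasure; exact: Prop_irrelevance.
Qed.

Lemma pm_zero_subproof (B : set (borel X)) :
  measurable B -> bounded_subset B -> exists n : nat, lf_zero B = (n%:R)%:E.
Proof. by move=> _ _; exists 0%N. Qed.

Definition pm_zero := PointMeasure pm_zero_subproof.

Lemma pm_add_subproof (mu nu : pointmeasure) (B : set (borel X)) :
  measurable B -> bounded_subset B -> exists n : nat, lf_add mu nu B = (n%:R)%:E.
Proof.
move=> mB bB; have [m muB] := pm_integer mu mB bB.
have [n nuB] := pm_integer nu mB bB; exists (m + n)%N.
rewrite [LHS](measure_addE mu nu B).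
by rewrite [X in (X + _)%E]muB [X in (_ + X)%E]nuB natrD EFinD.
Qed.

Definition pm_add (mu nu : pointmeasure) :=
  PointMeasure (@pm_add_subproof mu nu).

Lemma lf_dirac_subproof (x : borel X) (B : set (borel X)) :
  measurable B -> bounded_subset B ->
  ((\d_x : {measure set (borel X) -> \bar R}) B < +oo)%E.
Proof. by move=> _ _; rewrite /= diracE ltry. Qed.

Lemma pm_dirac_subproof (x : borel X) (B : set (borel X)) :
  measurable B -> bounded_subset B ->
  exists n : nat, LFMeasure (@lf_dirac_subproof x) B = (n%:R)%:E.
Proof. by move=> _ _; exists (x \in B); rewrite /= diracE. Qed.

Definition pm_dirac (x : X) := PointMeasure (@pm_dirac_subproof x).

HB.instance Definition _ := gen_eqMixin pointmeasure.
HB.instance Definition _ := gen_choiceMixin pointmeasure.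
HB.instance Definition _ := isPointed.Build pointmeasure pm_zero.
HB.instance Definition _ :=
  Topological.copy pointmeasure (initial_topology pm_measure).

(* If nu <= mu setwise, then mu - nu is the only point measure d such that
   nu + d = mu: the values on bounded sets, which are finite, determine d. *)
Definition pm_sub (mu nu : pointmeasure) : pointmeasure :=
  get [set d | pm_add nu d = mu].

Definition polya_sum (z : R) (kappa : lfmeasure)
    (S : {measure set (borel pointmeasure) -> \bar R}) : Prop :=
  S setT = 1%E /\
  forall h : (borel X * borel pointmeasure)%type -> \bar R,
    measurable_fun [set: borel X * borel pointmeasure] h ->
    (forall u, 0 <= h u)%E ->
    (\int[S]_mu \int[pm_measure mu]_x h (x, mu) =
     \int[S]_mu (z%:E *
       \int[lf_add kappa mu]_x h (x, pm_add mu (pm_dirac x))))%E.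

Definition occupied (B : set X) (mu : pointmeasure) (j : nat) : set X :=
  [set x | B x /\ mu [set x] = (j%:R)%:E].

Lemma measurable_point (x : X) : (@measurable _ (borel X)) [set x].
Proof.
rewrite -[X in measurable X]setCK; apply: measurableC; apply: sub_sigma_algebra.
exact/closed_openC/accessible_closed_set1/hausdorff_accessible/metric_hausdorff.
Qed.

(* fset_set is empty on infinite sets; this shows that the cardinality in
   occupation is never computed from that default value. *)
Lemma occupied_finite (B : set (borel X)) (mu : pointmeasure) (j : nat) :
  measurable B -> bounded_subset B -> (0 < j)%N -> finite_set (occupied B mu j).
Proof.
move=> mB bB j0; apply: contrapT => /(@infinite_set_fset (borel X)) Binf.
have [m muB] := pm_integer mu mB bB.
have [C CB mC] := Binf m.+1.
have mset1 (x : borel X) : measurable [set x] by exact: measurable_point.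
have : (mu (\big[setU/set0]_(x <- C) [set x]) <= mu B)%E.
  apply: le_measure; rewrite ?inE//.
  - by apply: bigsetU_measurable => x _; exact: mset1.
  - by rewrite -bigcup_fset => x [y /= yC ->]; have [] := CB y yC.
rewrite measure_fbigsetU//; last first.
  by move=> x y _ _ [z [/= -> ->]].
rewrite (eq_big_seq (fun=> (j%:R)%:E)); last by move=> x /CB[].
rewrite muB sumEFin lee_fin big_const_seq count_predT iter_addr_0.
rewrite -mulrnA ler_nat leqNgt => /negP; apply.
by rewrite (leq_trans mC)// leq_pmull.
Qed.

(* Measures on {1, 2, ...}, as measures on nat that do not charge 0. *)
Definition weighted_measure (w : nat -> {nonneg R}) :
    {measure set nat -> \bar R} :=
  mseries (fun j => mscale (w j) \d_j) 1.

Definition occupation (B : set X) (mu : pointmeasure) :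
    {measure set nat -> \bar R} :=
  weighted_measure (fun j => (#|` fset_set (occupied B mu j)|%:R)%:nng).

Definition vague_cvg_nat (m : nat -> {measure set nat -> \bar R})
    (l : {measure set nat -> \bar R}) : Prop :=
  forall j : nat, (0 < j)%N -> m n [set j] @[n --> \oo] --> l [set j].

Definition log_measure (t : {nonneg R}) : {measure set nat -> \bar R} :=
  weighted_measure (fun j => (t%:num ^+ j / j%:R)%:nng).

Lemma fine_measure_ge0 (rho : lfmeasure) (B : set X) :
  0 <= (fine (rho B))^-1.
Proof. by rewrite invr_ge0 fine_ge0. Qed.

Definition normalized_occupation (rho : lfmeasure) (B : set X)
    (mu : pointmeasure) : {measure set nat -> \bar R} :=
  mscale (NngNum (fine_measure_ge0 rho B)) (occupation B mu).

Section processes.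
Context (d : measure_display) (Omega : measurableType d)
        (P : probability Omega R).

Definition history (Y : R -> Omega -> borel pointmeasure) (s : R) :
    set (set Omega) :=
  <<s [set E | exists (u : R) (A : set (borel pointmeasure)),
         [/\ 0 <= u <= s, measurable A & E = Y u @^-1` A]] >>.

(* g (Y s) is a version of the conditional probability of Y t \in A given
   the past up to time s *)
Definition markov_process (Y : R -> Omega -> borel pointmeasure) : Prop :=
  forall s t : R, 0 <= s -> s <= t -> t < 1 ->
  forall A : set (borel pointmeasure), measurable A ->
  exists g : borel pointmeasure -> \bar R,
    [/\ measurable_fun setT g, forall mu, (0 <= g mu)%E &
        forall E, history Y s E ->
          P (E `&` Y t @^-1` A) = (\int[P]_(w in E) g (Y s w))%E].

Definition regular_conditional_law (D Z : Omega -> borel pointmeasure)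
    (K : R.-pker (borel pointmeasure) ~> (borel pointmeasure)) : Prop :=
  forall A C : set (borel pointmeasure), measurable A -> measurable C ->
    P (Z @^-1` C `&` D @^-1` A) = (\int[P]_(w in Z @^-1` C) K (Z w) A)%E.

Record spatial_crp (rho : lfmeasure) (Y : R -> Omega -> borel pointmeasure) :
    Prop := SpatialCRP {
  crp_measurable : forall t : R, 0 <= t < 1 -> measurable_fun setT (Y t) ;
  crp_start : forall w, Y 0 w = pm_zero ;
  crp_increasing : forall w (s t : R), 0 <= s -> s <= t -> t < 1 ->
    forall A : set (borel X), measurable A ->
    (pm_measure (Y s w) A <= pm_measure (Y t w) A)%E ;
  crp_right_continuous : forall w (t : R), 0 <= t < 1 ->
    (Y u w : pointmeasure) @[u --> t^'+] --> (Y t w : pointmeasure) ;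
  crp_left_limits : forall w (t : R), 0 < t < 1 ->
    exists l : pointmeasure, (Y u w : pointmeasure) @[u --> t^'-] --> l ;
  crp_markov : markov_process Y ;
  crp_increments : forall s t : R, 0 <= s -> s < t -> t < 1 ->
    exists K : R.-pker (borel pointmeasure) ~> (borel pointmeasure),
      (forall mu : pointmeasure,
         polya_sum ((t - s) / (1 - s)) (lf_add rho mu) (K mu)) /\
      regular_conditional_law (fun w => pm_sub (Y t w) (Y s w)) (Y s) K }.

End processes.

End locally_finite_measures.

(* Main.v *)
Require Import Defs.
From HB Require Import structures.
From mathcomp Require Import all_boot all_order all_algebra.
From mathcomp Require Import finmap.
From mathcomp Require Import all_classical all_reals all_analysis.
From mathcomp Require Import measurable_realfun.
From mathcomp Require Import lra ring.

Set Implicit Arguments.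
Unset Strict Implicit.
Unset Printing Implicit Defensive.

Import Order.TTheory GRing.Theory Num.Theory.
Import numFieldNormedType.Exports.

Local Open Scope classical_set_scope.
Local Open Scope ring_scope.

(** The number of atoms of a given size in B is not monotone in time, but the
    mass carried by the large atoms, G_j(B, mu) = mu {x in B | j <= mu {x}},
    increases with both B and mu.
    Nothing is lost by looking at it, since j times the number of atoms of size
    j >= 1 in B is G_j(B, mu) - G_(j+1)(B, mu) ([occupied_massE]). It is
    therefore enough that, almost surely, G_j(B_n, Y_t) / rho(B_n) tends to
    t^j / (1 - t) for all j >= 1 and all t: the differences of these limits are
    t^j.

    For a fixed t in (0, 1), Y_t follows the law with integral equation
    E int h(x, mu) mu(dx) = E int h(x, mu + delta_x) z (kappa + mu)(dx), where
    z = t and kappa = rho. Take h(x, mu) = 1[x in B, i <= mu {x}] F(mu). A point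
    added at x raises mu {x} by 1, so the condition i <= mu {x} becomes
    i - 1 <= mu {x}, and E (G_i F) is expressed through G_(i-1)
    ([mecke_heavy_mass]). The measure kappa contributes only when i <= 1,
    because it is diffuse and mu has countably many atoms. With F = 1 this gives
    E G_j = kappa(B) z^j / (1 - z) ([integral_heavy_mass]). With F = G_j it
    gives E G_j^2 <= (E G_j)^2 + C kappa(B), hence a variance of order kappa(B)
    ([heavy_mass_variance]). The equation for the total mass G_0 alone reads
    e = z (kappa(B) + e), which e = +oo also solves: finiteness is obtained
    beforehand by restricting to the event mu(B) <= m, uniformly in m.

    After division by rho(B_n), the mean square deviation from the limit is at
    most C / rho(B_n), which is summable along indices at which rho(B_n) exceeds the
    successive squares, so convergence holds almost surely along them. Since G_j
    increases with B_n and the ratio of consecutive squares tends to 1, it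
    extends to the whole sequence ([cvg_ratio_blocks]). Finally, the exceptional
    null sets of the countably many rational times are put together, and
    monotonicity in t with the continuity of t^j / (1 - t) covers all times
    ([cvg_monotone_rat]).

    All this requires mu |-> G_j(B, mu) to be a Borel function for the vague
    topology; this is where the metric and the separability of X are used. *)

(** * Borel measurability in the vague topology *)

Section vague_measurability.
Context (R : realType) (X : polishType R).
Local Notation PM := (borel (pointmeasure X)).

Lemma ball_open (x : X) (r : R) : open (ball x r).
Proof.
rewrite openE => y; rewrite ballEmdist /= => xyr.
apply/nbhs_ballP; exists (r - mdist x y) => /=; first by rewrite subr_gt0.
move=> z; rewrite !ballEmdist /= ltrBrDl => yz.
exact: le_lt_trans (metric_triangle _ _ _) yz.
Qed.

Lemma measurable_open (U : set (borel X)) : open (U : set X) -> measurable U.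
Proof. by move=> oU; apply: sub_sigma_algebra; exact: oU. Qed.

Lemma measurable_ball (x : X) (r : R) : measurable (ball x r : set (borel X)).
Proof. by apply: measurable_open; exact: ball_open. Qed.

Lemma bounded_subset_ball (x : X) (r : R) : bounded_subset (ball x r).
Proof. by exists x, r. Qed.

Lemma sub_bounded (A B : set X) : A `<=` B -> bounded_subset B ->
  bounded_subset A.
Proof. by move=> AB [x [r Br]]; exists x, r; exact: subset_trans Br. Qed.

Lemma pointmeasure_fin (mu : pointmeasure X) (B : set (borel X)) :
  measurable B -> bounded_subset B -> mu B \is a fin_num.
Proof. by move=> mB bB; have [n ->] := pm_integer mu mB bB. Qed.

Lemma continuous_measurable (f : X -> R) : continuous f ->
  measurable_fun setT (f : borel X -> R).
Proof.
move=> cf; apply: (measurability _ (RGenOInfty.measurableE R)) => //.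
move=> /= _ [_ [a ->] <-]; rewrite setTI; apply: measurable_open.
by apply: open_comp => //; move=> x _; exact: cf.
Qed.

Lemma measurable_vague_eval (f : set_type (@vague_test R X)) :
  measurable_fun setT (fun mu : PM => vague_eval (pm_measure mu) f).
Proof.
apply: (measurability _ (RGenOInfty.measurableE R)) => //.
move=> /= _ [_ [a ->] <-]; rewrite setTI; apply: sub_sigma_algebra.
pose V := [set g : prod_topology (fun _ : set_type (@vague_test R X) => R) |
            a < g f].
suff oV : open V.
  exists (@vague_eval R X @^-1` V); first by exists V.
  by rewrite /V; apply/seteqP; split => mu /=; rewrite in_itv/= andbT.
have /continuousP pf : continuous
    (proj f : prod_topology (fun _ : set_type (@vague_test R X) => R) -> R).
  exact: proj_continuous.
by apply: (pf [set x | a < x]); exact: open_gt.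
Qed.

(** The largest [n]-Lipschitz function below the indicator of [U]. For [U] open
    and bounded these functions are admissible in the definition of the vague
    topology, and they increase to the indicator of [U]. *)
Definition lipschitz_envelope (U : set X) (n : nat) (x : X) : R :=
  inf [set \1_U y + n%:R * mdist x y | y in [set: X]].

Section lipschitz_envelope_lemmas.
Variable U : set X.

Let envelope_lb (n : nat) (x : X) :
  lbound [set \1_U y + n%:R * mdist x y | y in [set: X]] 0.
Proof. by move=> _ [y _ <-]; rewrite addr_ge0// mulr_ge0// mdist_ge0. Qed.

Let envelope_inf (n : nat) (x : X) :
  has_inf [set \1_U y + n%:R * mdist x y | y in [set: X]].
Proof. by split; [exists (\1_U x + n%:R * mdist x x), x|exists 0]. Qed.

Lemma lipschitz_envelope_ge0 n x : 0 <= lipschitz_envelope U n x.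
Proof. by apply: lb_le_inf; [case: (envelope_inf n x)|exact: envelope_lb]. Qed.

Lemma lipschitz_envelope_le n x y :
  lipschitz_envelope U n x <= \1_U y + n%:R * mdist x y.
Proof. by apply: ge_inf; [exists 0; exact: envelope_lb|exists y]. Qed.

Lemma lipschitz_envelope_le_indic n x : lipschitz_envelope U n x <= \1_U x.
Proof.
by have := lipschitz_envelope_le n x x; rewrite mdistxx mulr0 addr0.
Qed.

Lemma lipschitz_envelope_dist n x y :
  lipschitz_envelope U n x <= lipschitz_envelope U n y + n%:R * mdist x y.
Proof.
rewrite -lerBlDr; apply: lb_le_inf; first by case: (envelope_inf n y).
move=> _ [z _ <-]; rewrite lerBlDr (le_trans (lipschitz_envelope_le n x z))//.
by rewrite -addrA lerD2l -mulrDr ler_wpM2l// addrC metric_triangle.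
Qed.

Lemma continuous_lipschitz_envelope n : continuous (lipschitz_envelope U n).
Proof.
move=> x; apply/cvgrPdist_lt => e e0.
near=> y; have xy : mdist x y < e / n.+1%:R.
  have : ball x (e / n.+1%:R) y.
    by near: y; apply: nbhsx_ballx; rewrite divr_gt0.
  by rewrite ballEmdist.
rewrite (@le_lt_trans _ _ (n%:R * mdist x y))//.
  rewrite ler_norml; apply/andP; split.
    by have := lipschitz_envelope_dist n y x; rewrite metric_sym; lra.
  by have := lipschitz_envelope_dist n x y; lra.
rewrite (@le_lt_trans _ _ (n.+1%:R * mdist x y))//.
  by rewrite ler_wpM2r ?mdist_ge0// ler_nat.
by rewrite mulrC -ltr_pdivlMr.
Unshelve. all: by end_near. Qed.

Lemma nondecreasing_lipschitz_envelope x :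
  {homo (lipschitz_envelope U)^~ x : m n / (m <= n)%N >-> m <= n}.
Proof.
move=> m n mn; apply: lb_le_inf; first by case: (envelope_inf n x).
move=> _ [y _ <-]; apply: (le_trans (lipschitz_envelope_le m x y)).
by rewrite lerD2l ler_wpM2r ?mdist_ge0// ler_nat.
Qed.

Lemma cvg_lipschitz_envelope x : open U ->
  lipschitz_envelope U n x @[n --> \oo] --> (\1_U x : R).
Proof.
move=> oU; have [Ux|nUx] := pselect (U x); last first.
  rewrite (_ : lipschitz_envelope U ^~ x = fun=> \1_U x); first exact: cvg_cst.
  apply/funext => n; apply/eqP; rewrite eq_le lipschitz_envelope_le_indic/=.
  by rewrite indicE memNset// lipschitz_envelope_ge0.
move: oU; rewrite openE => /(_ x Ux)/nbhs_ballP[e /= e0 xeU].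
apply: cvg_near_cst; near=> n; apply/eqP; rewrite eq_le.
rewrite lipschitz_envelope_le_indic/=.
apply: lb_le_inf; first by case: (envelope_inf n x).
move=> _ [y _ <-]; rewrite indicE mem_set//.
have [xy|xy] := ltP (mdist x y) e.
  rewrite indicE mem_set ?lerDl ?mulr_ge0 ?mdist_ge0//.
  by apply: xeU; rewrite ballEmdist.
rewrite (@le_trans _ _ (n%:R * mdist x y))// ?lerDr//.
rewrite (@le_trans _ _ (n%:R * e)) ?ler_wpM2l//.
rewrite -ler_pdivrMr// div1r.
by near: n; exact: nbhs_infty_ger.
Unshelve. all: by end_near. Qed.

End lipschitz_envelope_lemmas.

(** Monotone convergence along the Lipschitz envelopes of [U], whose integrals
    are continuous in [mu]. *)
Lemma measurable_eval_open (U : set (borel X)) :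
  open (U : set X) -> bounded_subset U ->
  measurable_fun setT (fun mu : PM => pm_measure mu U).
Proof.
move=> oU bU; have mU := measurable_open oU.
have ft n : @vague_test R X (lipschitz_envelope U n).
  split.
  - exact: continuous_lipschitz_envelope.
  - exact: lipschitz_envelope_ge0.
  - exists 1 => x; apply: (le_trans (lipschitz_envelope_le_indic _ _ _)).
    by rewrite indicE; case: (_ \in _).
  - apply: sub_bounded bU => x /= fx0; apply: contrapT => nUx.
    move: fx0; apply/negP; rewrite negbK eq_le lipschitz_envelope_ge0 andbT.
    by have := lipschitz_envelope_le_indic U n x; rewrite indicE memNset.
pose f n : set_type (@vague_test R X) := SigSub (mem_set (ft n)).
have mf n : measurable_fun setT (lipschitz_envelope U n : borel X -> R).
  by apply: continuous_measurable; exact: continuous_lipschitz_envelope.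
have fE n (mu : PM) : (vague_eval (pm_measure mu) (f n))%:E =
    (\int[pm_measure mu]_x (lipschitz_envelope U n x)%:E)%E.
  rewrite /vague_eval /Rintegral /= fineK//.
  rewrite ge0_fin_numE; last first.
    by apply: integral_ge0 => x _; rewrite lee_fin lipschitz_envelope_ge0.
  rewrite (@le_lt_trans _ _ (\int[pm_measure mu]_x (\1_U x)%:E)%E)//.
    apply: ge0_le_integral => //.
    - by move=> x _; rewrite lee_fin lipschitz_envelope_ge0.
    - exact/measurable_EFinP.
    - exact/measurable_EFinP/measurable_indic.
    - by move=> x _; rewrite lee_fin lipschitz_envelope_le_indic.
  by rewrite integral_indic// setIT -ge0_fin_numE// pointmeasure_fin.
apply: (emeasurable_fun_cvg
  (fun n (mu : PM) => (vague_eval (pm_measure mu) (f n))%:E)).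
  by move=> n; apply/measurable_EFinP; exact: measurable_vague_eval.
move=> mu _; under eq_fun do rewrite fE.
have limE x : limn (fun n => (lipschitz_envelope U n x)%:E) = (\1_U x)%:E.
  apply/cvg_lim => //; apply: cvg_EFin; first by near=> n.
  exact: cvg_lipschitz_envelope.
have -> : pm_measure mu U = (\int[pm_measure mu]_x
    limn (fun n => (lipschitz_envelope U n x)%:E))%E.
  under eq_integral do rewrite limE.
  by rewrite integral_indic// setIT.
apply: (@cvg_monotone_convergence _ _ _ _ _ measurableT
  (fun n (x : borel X) => (lipschitz_envelope U n x)%:E)).
- by move=> n; exact/measurable_EFinP.
- by move=> n x _; rewrite lee_fin lipschitz_envelope_ge0.
- by move=> x _ m n mn; rewrite lee_fin nondecreasing_lipschitz_envelope.
Unshelve. all: by end_near. Qed.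

(** Dynkin's argument, carried out inside one ball [V] around [B]: on [V] all the
    measures are finite, so complements can be subtracted. *)
Lemma measurable_eval (B : set (borel X)) :
  measurable B -> bounded_subset B ->
  measurable_fun setT (fun mu : PM => pm_measure mu B).
Proof.
move=> mB [x0 [r Br]].
pose V : set (borel X) := ball x0 r.
have oV : open (V : set X) by exact: ball_open.
have mV : measurable V by exact: measurable_open.
have bV : bounded_subset V by exact: bounded_subset_ball.
have bIV (A : set X) : bounded_subset (A `&` V).
  by apply: sub_bounded bV; exact: subIsetr.
pose H := [set A : set (borel X) | measurable A /\
  measurable_fun setT (fun mu : PM => pm_measure mu (A `&` V))].
have HB : H B.
  have mE : @measurable _ (borel X) `<=` <<s (@open X) >> by [].
  apply: (@lambda_system_subset _ (@open X) _ setT H) => //.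
  - by move=> A C; exact: openI.
  - split => //.
    + split; first exact: measurableT.
      by rewrite setTI; exact: measurable_eval_open.
    + move=> A C CA [mA HA] [mC HC]; split; first exact: measurableD.
      rewrite (_ : (fun mu : PM => _) =
        fun mu : PM => (pm_measure mu (A `&` V) - pm_measure mu (C `&` V))%E).
        exact: emeasurable_funB.
      apply/funext => mu.
      have -> : (A `\` C) `&` V = (A `&` V) `\` (C `&` V).
        apply/seteqP; split => [x [[Ax nCx] Vx]|x [[Ax Vx] nCV]].
          by split => // -[].
        by split => //; split => // Cx; exact: nCV.
      rewrite measureD; last 3 first.
      * exact: measurableI.
      * exact: measurableI.
      * by rewrite -ge0_fin_numE// pointmeasure_fin//; exact: measurableI.
      by rewrite [X in (_ - pm_measure mu X)%E]setIidr//; exact: setSI.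
    + move=> F'; pose F : (set (borel X))^nat := F'; rewrite -/F => ndF HF.
      have mF n : measurable (F n) by case: (HF n).
      split; first exact: bigcupT_measurable.
      apply: (emeasurable_fun_cvg
        (fun n (mu : PM) => pm_measure mu (F n `&` V))).
        by move=> n; case: (HF n).
      move=> mu _; rewrite setI_bigcupl.
      apply: (@nondecreasing_cvg_mu _ _ _ (pm_measure mu)
        (fun n => F n `&` V)).
      * by move=> n; exact: measurableI.
      * by apply: bigcupT_measurable => n; exact: measurableI.
      * move=> m n mn; apply/subsetPset; apply: setSI.
        by have /subsetPset := ndF m n mn.
  - move=> U oU; split; first exact: measurable_open.
    by apply: measurable_eval_open => //; exact: openI.
by case: HB => _; rewrite setIidl.
Qed.

(** By separability the set is a countable combination of rectangles: [mu] has
    mass at least [j] at [x] if and only if, for all [n], some ball of radius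
    [n.+1^-1] centred in the countable dense set contains [x] and has mass at
    least [j]. *)
Lemma measurable_heavy_pairs (j : nat) :
  measurable [set p : PM * borel X | (j%:R%:E <= pm_measure p.1 [set p.2])%E].
Proof.
have [D cD dD] := @separable_dense R X.
case: (pfcard_geP cD) => [D0|[q]].
  rewrite (_ : [set p | _] = set0)//; apply/seteqP; split => // -[mu x] _.
  have [] := dD setT; [by exists x|exact: openT|].
  by move=> y; rewrite D0 => -[].
have q_dense (x : X) (n : nat) : exists i, ball (q i) n.+1%:R^-1 x.
  have [|y [xy Dy]] := dD _ _ (ball_open x n.+1%:R^-1).
    by exists x; apply: ballxx.
  by have [i _ qi] := 'surj_q Dy; exists i; rewrite qi; exact: ball_sym.
rewrite (_ : [set p | _] = \bigcap_n \bigcup_i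
    ([set mu : PM | (j%:R%:E <= pm_measure mu (ball (q i) n.+1%:R^-1))%E] `*`
     (ball (q i) n.+1%:R^-1 : set (borel X)))).
  apply: bigcapT_measurable => n; apply: bigcupT_measurable => i.
  apply: measurableX; last exact: measurable_ball.
  rewrite -[X in measurable X]setTI; apply: emeasurable_fun_c_infty => //.
  by apply: measurable_eval; [exact: measurable_ball|exact: bounded_subset_ball].
apply/seteqP; split => -[mu x] /=.
  move=> jx n _; have [i xi] := q_dense x n; exists i => //; split => //=.
  apply: (le_trans jx); apply: le_measure; rewrite ?inE.
  - exact: measurable_point.
  - exact: measurable_ball.
  - by move=> _ ->.
(* These balls around [x] contain the ones given by [H], and shrink to [x]. *)
move=> H; pose F n : set (borel X) := ball x (2 * n.+1%:R^-1).
have mF n : measurable (F n) by exact: measurable_ball.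
have F_dec : nonincreasing_seq F.
  move=> m n mn; apply/subsetPset; apply: le_ball.
  by rewrite ler_pM2l// lef_pV2 ?posrE// ler_nat.
have FE : \bigcap_n F n = [set x].
  apply/seteqP; split => [y Fy|y -> n _]; last exact: ballxx.
  apply/esym/mdist_positivity/eqP; rewrite eq_le mdist_ge0 andbT.
  apply/ler_addgt0Pl => e e0; rewrite addr0.
  near \oo => n; have := Fy n Logic.I; rewrite /F ballEmdist /= => /ltW xy.
  apply: (le_trans xy); rewrite -ler_pdivlMl// mulrC.
  rewrite -[leRHS]invrK lef_pV2 ?posrE ?invr_gt0 ?divr_gt0//.
  rewrite (@le_trans _ _ n%:R)// ?ler_nat//.
  by near: n; exact: nbhs_infty_ger.
have cF : (pm_measure mu \o F) n @[n --> \oo] --> pm_measure mu [set x].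
  rewrite -FE; apply: nonincreasing_cvg_mu => //.
    rewrite -ge0_fin_numE//; apply: pointmeasure_fin => //.
    exact: bounded_subset_ball.
  by rewrite FE; exact: measurable_point.
rewrite -(cvg_lim _ cF)//; apply: lime_ge.
- by apply/cvg_ex; exists (pm_measure mu [set x]).
- apply: nearW => n /=; have [i _ [/= ji xi]] := H n Logic.I.
  apply: (le_trans ji); apply: le_measure; rewrite ?inE//.
    exact: measurable_ball.
  move=> y iy; rewrite /F mulr2n mulrDl !mul1r.
  exact: ball_triangle (ball_sym xi) iy.
Unshelve. all: by end_near. Qed.

(** The restrictions of [mu] to a bounded set form a kernel of finite measures,
    to which the measurability of sections applies. *)
Section kernel.
Variables (B : set (borel X)) (mB : measurable B) (bB : bounded_subset B).

Definition restricted_eval (mu : PM) : {measure set (borel X) -> \bar R} :=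
  mrestr (pm_measure mu) mB.

Let measurable_restricted_eval (A : set (borel X)) : measurable A ->
  measurable_fun setT (restricted_eval ^~ A).
Proof.
move=> mA; apply: measurable_eval; first exact: measurableI.
by apply: sub_bounded bB; exact: subIsetr.
Qed.

HB.instance Definition _ :=
  isKernel.Build _ _ _ _ _ restricted_eval measurable_restricted_eval.

Lemma measurable_eval_xsection (A : set (PM * borel X)) : measurable A ->
  measurable_fun setT (fun mu : PM => pm_measure mu (B `&` xsection A mu)).
Proof.
move=> mA.
have : forall mu, exists M, forall C, measurable C ->
    (mrestr (restricted_eval mu) measurableT C < M%:E)%E.
  move=> mu; exists (fine (pm_measure mu B) + 1) => C mC.
  rewrite /mrestr/= /mrestr setIT EFinD fineK ?pointmeasure_fin//.
  rewrite (@le_lt_trans _ _ (pm_measure mu B))//.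
    by apply: le_measure; rewrite ?inE//; exact: measurableI.
  by rewrite lteDl ?pointmeasure_fin// lte_fin.
move=> /(@measurable_prod_subset_xsection_kernel _ _ _ _ _ restricted_eval
  setT measurableT) /(_ _ mA)[_]; rewrite /mrestr/= /mrestr.
by under eq_fun do rewrite setIT setIC.
Qed.
End kernel.
End vague_measurability.

(** * The mass of the large atoms *)

Section heavy_atoms.
Context (R : realType) (X : polishType R).
Local Notation PM := (borel (pointmeasure X)).
Implicit Types (B : set (borel X)) (mu : pointmeasure X).
Local Open Scope ereal_scope.

Definition heavy_atoms B (j : nat) mu : set (borel X) :=
  B `&` [set x | j%:R%:E <= mu [set x]].

Definition heavy_mass B j mu : \bar R := pm_measure mu (heavy_atoms B j mu).

Lemma heavy_atoms0 B mu : heavy_atoms B 0 mu = B.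
Proof.
by apply/seteqP; split => [x []|x Bx]//; split => //=; exact: measure_ge0.
Qed.

Lemma heavy_mass0 B mu : heavy_mass B 0 mu = pm_measure mu B.
Proof. by rewrite /heavy_mass heavy_atoms0. Qed.

Lemma heavy_atomsE B j mu : heavy_atoms B j mu = B `&` xsection
  [set p : PM * borel X | j%:R%:E <= pm_measure p.1 [set p.2]] mu.
Proof.
by congr (_ `&` _); apply/seteqP; split => x; rewrite /xsection /= inE.
Qed.

Lemma measurable_heavy_atoms B j mu : measurable B ->
  measurable (heavy_atoms B j mu).
Proof.
move=> mB; rewrite heavy_atomsE; apply: measurableI => //.
by apply: measurable_xsection; exact: measurable_heavy_pairs.
Qed.

Lemma bounded_heavy_atoms B j mu : bounded_subset B ->
  bounded_subset (heavy_atoms B j mu).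
Proof. by apply: sub_bounded; exact: subIsetl. Qed.

Lemma measurable_heavy_mass B j : measurable B -> bounded_subset B ->
  measurable_fun setT (heavy_mass B j : PM -> \bar R).
Proof.
move=> mB bB; rewrite /heavy_mass; under eq_fun do rewrite heavy_atomsE.
by apply: measurable_eval_xsection => //; exact: measurable_heavy_pairs.
Qed.

Lemma heavy_mass_ge0 B j mu : 0 <= heavy_mass B j mu.
Proof. exact: measure_ge0. Qed.

Lemma heavy_mass_fin B j mu : measurable B -> bounded_subset B ->
  heavy_mass B j mu \is a fin_num.
Proof.
move=> mB bB; apply: pointmeasure_fin; first exact: measurable_heavy_atoms.
exact: bounded_heavy_atoms.
Qed.

Lemma heavy_mass_le B j mu : measurable B -> heavy_mass B j mu <= pm_measure mu B.
Proof.
move=> mB; apply: le_measure; rewrite ?inE//.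
- exact: measurable_heavy_atoms.
- exact: subIsetl.
Qed.

Lemma heavy_mass_subset (B B' : set (borel X)) j mu : measurable B ->
  measurable B' -> B `<=` B' -> heavy_mass B j mu <= heavy_mass B' j mu.
Proof.
move=> mB mB' BB'; apply: le_measure; rewrite ?inE; try exact: measurable_heavy_atoms.
exact: setSI.
Qed.

Lemma heavy_mass_homo B j mu nu : measurable B ->
  (forall A : set (borel X), measurable A -> pm_measure mu A <= pm_measure nu A) ->
  heavy_mass B j mu <= heavy_mass B j nu.
Proof.
move=> mB munu; apply: (le_trans (munu _ (measurable_heavy_atoms j mu mB))).
apply: le_measure; rewrite ?inE; try exact: measurable_heavy_atoms.
move=> x [Bx /= jx]; split => //=; apply: (le_trans jx); apply: munu.
exact: measurable_point.
Qed.

Lemma pm_add_diracE mu (x : X) (A : set (borel X)) :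
  pm_measure (pm_add mu (pm_dirac x)) A = pm_measure mu A + (\1_A x)%:E.
Proof. by rewrite [LHS](measure_addE (pm_measure mu) _ A) /= diracE. Qed.

(** The mechanism behind the recursion on [j]. For [j = 0] both sides say [B x],
    which is why the truncated predecessor is the right index. *)
Lemma heavy_atoms_add_dirac B j mu (x : X) :
  heavy_atoms B j (pm_add mu (pm_dirac x)) x <-> heavy_atoms B j.-1 mu x.
Proof.
have fx : pm_measure mu [set x] \is a fin_num.
  apply: pointmeasure_fin; first exact: measurable_point.
  by exists x, 1%R => _ ->; exact: ballxx.
rewrite /heavy_atoms /= pm_add_diracE indicE mem_set//= -(fineK fx) -EFinD !lee_fin.
case: j => [|j] /=; first by rewrite addr_ge0 ?fine_ge0.
by rewrite -natr1 lerD2r.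
Qed.

(** Adding a point to [x] adds 1 if [x] was large already, and lets an atom of
    size at most [j] enter otherwise. *)
Lemma heavy_mass_add_dirac B j mu (x : X) : measurable B -> B x ->
  heavy_mass B j (pm_add mu (pm_dirac x)) <= heavy_mass B j mu + j.+1%:R%:E.
Proof.
move=> mB Bx; set nu := pm_add _ _.
have mA := measurable_heavy_atoms j mu mB.
have mx := measurable_point x.
rewrite /heavy_mass {1}/nu pm_add_diracE -natr1 EFinD addeA; apply: leeD; last first.
  by rewrite lee_fin indicE; case: (_ \in _).
have [xj|xj] := leP j%:R%:E (pm_measure mu [set x]).
  rewrite -[leLHS]adde0; apply: leeD => //.
  apply: le_measure; rewrite ?inE//; first exact: measurable_heavy_atoms.
  move=> y [By]; rewrite /= pm_add_diracE indicE.
  have [->|yx] := eqVneq y x; first by split.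
  by rewrite memNset ?adde0// => xy; move: yx; rewrite /= xy eqxx.
apply: (@le_trans _ _ (pm_measure mu (heavy_atoms B j mu `|` [set x]))).
  apply: le_measure; rewrite ?inE//; [exact: measurable_heavy_atoms|exact: measurableU|].
  move=> y [By]; rewrite /= pm_add_diracE indicE.
  have [->|yx] := eqVneq y x; first by right.
  by rewrite memNset ?adde0// => [?|xy]; [left|move: yx; rewrite /= xy eqxx].
apply: (le_trans (measureU2 _ _ _)) => //.
by apply: leeD => //; exact: ltW.
Qed.

(** The masses of the points are integers, so the large atoms lie in a countable
    union of finite sets. *)
Lemma diffuse_heavy_atoms (kappa : lfmeasure X) B j mu :
  (forall x : X, kappa [set x] = 0) -> measurable B -> bounded_subset B ->
  kappa (heavy_atoms B j.+1 mu) = 0.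
Proof.
move=> kappa0 mB bB.
have sub : heavy_atoms B j.+1 mu `<=` \bigcup_k occupied B mu k.+1.
  move=> x [Bx /= jx].
  have [||n xn] := @pm_integer _ _ mu [set x]; first exact: measurable_point.
    by exists x, 1%R => _ ->; exact: ballxx.
  move: jx; rewrite xn lee_fin ler_nat; case: n xn => // n xn _.
  by exists n.
have fo k : finite_set (occupied B mu k.+1) by exact: occupied_finite.
have cA : countable (heavy_atoms B j.+1 mu).
  apply: (sub_countable (subset_card_le sub)).
  by apply: bigcup_countable => // k _; exact: finite_set_countable.
apply: measure_negligible; first exact: measurable_heavy_atoms.
have /countable_injP[f finj] := cA.
apply: (@negligibleS _ _ _ kappa
  (\bigcup_n (heavy_atoms B j.+1 mu `&` f @^-1` [set n]))).
  by move=> x Ax; exists (f x).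
apply: negligible_bigcup => n.
have [->|/set0P[x [Ax fx]]] := eqVneq (heavy_atoms B j.+1 mu `&` f @^-1` [set n]) set0.
  exact: negligible_set0.
exists [set x]; split; [exact: measurable_point|exact: kappa0|].
move=> y [Ay fy]; apply: finj; rewrite ?inE//.
by rewrite /= in fx fy; rewrite fx fy.
Qed.

Definition heavy_massR B j mu : R := fine (heavy_mass B j mu).

Lemma heavy_massE B j mu : measurable B -> bounded_subset B ->
  heavy_mass B j mu = (heavy_massR B j mu)%:E.
Proof. by move=> mB bB; rewrite fineK// heavy_mass_fin. Qed.

Lemma heavy_massR_ge0 B j mu : (0 <= heavy_massR B j mu)%R.
Proof. by rewrite fine_ge0// heavy_mass_ge0. Qed.

Lemma measurable_heavy_massR B j : measurable B -> bounded_subset B ->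
  measurable_fun setT (heavy_massR B j : PM -> R).
Proof.
move=> mB bB; apply: (measurableT_comp (f := fine)) => //.
exact: measurable_heavy_mass.
Qed.

End heavy_atoms.

(** * Moments of the Polya sum process *)

Section integral_monotone.
Import HBNNSimple.

(** The supremum over the simple functions below [f] grows with [f], be it
    measurable or not. The integral equation produces functions of [mu] whose
    measurability would otherwise have to be established first. *)
Lemma ge0_le_integral_pointwise d (T : measurableType d) (R : realType)
    (m : {measure set T -> \bar R}) (f g : T -> \bar R) :
  (forall x, 0 <= f x)%E -> (forall x, f x <= g x)%E ->
  (\int[m]_x f x <= \int[m]_x g x)%E.
Proof.
move=> f0 fg; have g0 x : (0 <= g x)%E by exact: le_trans (fg x).
rewrite !ge0_integralTE//; apply: ereal_sup_le => _ /= [h hf <-].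
by exists h => // x; exact: le_trans (fg x).
Qed.

End integral_monotone.

Section polya_sum_moments.
Context (R : realType) (X : polishType R).
Local Notation PM := (borel (pointmeasure X)).
Variables (z : R) (kappa : lfmeasure X) (S : {measure set PM -> \bar R}).
Hypotheses (z_ge0 : 0 <= z) (z_lt1 : z < 1).
Hypothesis kappa_diffuse : forall x : X, kappa [set x] = 0%E.
Hypothesis S_polya : polya_sum z kappa S.
Variable B : set (borel X).
Hypotheses (mB : measurable B) (bB : bounded_subset B).

Local Notation G := (heavy_mass B).
Local Notation k := (fine (kappa B)).

Let mG j : measurable_fun setT (G j : PM -> \bar R).
Proof. exact: measurable_heavy_mass. Qed.

Let k_ge0 : 0 <= k. Proof. by rewrite fine_ge0. Qed.

Let kappaB : kappa B = k%:E.
Proof. by rewrite fineK// ge0_fin_numE// lf_bounded_lty. Qed.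

(** The mass that [kappa] gives to the atoms of [mu] of size at least [j]: these
    form a [kappa]-null set, except for [j = 0] where they are all of [B]. *)
Definition fresh_mass (j : nat) : R := if j is 0 then k else 0.

Let fresh_mass_ge0 j : 0 <= fresh_mass j. Proof. by case: j. Qed.

Lemma added_mass_heavy_atoms j (mu : pointmeasure X) :
  lf_add kappa mu (heavy_atoms B j mu) = ((fresh_mass j)%:E + G j mu)%E.
Proof.
rewrite [LHS](measure_addE kappa mu (heavy_atoms B j mu)); congr (_ + _)%E.
case: j => [|j]; first by rewrite heavy_atoms0 kappaB.
exact: diffuse_heavy_atoms.
Qed.

Section mecke.
Local Open Scope ereal_scope.
Variable F : PM -> \bar R.
Hypotheses (mF : measurable_fun setT F) (F0 : forall mu, 0 <= F mu).

(** The integral equation for [F mu] times the indicator of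
    [heavy_atoms B j mu]. *)
Lemma mecke_heavy_mass j : \int[S]_mu (G j mu * F mu) =
  \int[S]_mu (z%:E * \int[lf_add kappa mu]_x
    ((\1_(heavy_atoms B j.-1 mu) x)%:E * F (pm_add mu (pm_dirac x)))).
Proof.
pose h (p : (borel X * PM)%type) : \bar R :=
  (\1_(heavy_atoms B j p.2) p.1)%:E * F p.2.
have mh : measurable_fun setT h.
  apply: emeasurable_funM; last exact: (measurableT_comp mF).
  apply/measurable_EFinP.
  rewrite (_ : (fun x : borel X * PM => _) = \1_((B `*` setT) `&`
      ((@unstable.swap _ _ : borel X * PM -> PM * borel X) @^-1` [set p : PM * borel X |
        j%:R%:E <= pm_measure p.1 [set p.2]]))).
    apply: measurable_indic; apply: measurableI; first exact: measurableX.
    rewrite -[X in measurable X]setTI; apply: measurable_swap => //.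
    exact: measurable_heavy_pairs.
  apply/funext => -[x mu] /=; rewrite !indicE; congr (_%:R); congr nat_of_bool.
  by apply/idP/idP; rewrite !inE /heavy_atoms /=; tauto.
have h0 p : 0 <= h p by rewrite mule_ge0// lee_fin.
have [_ /(_ h mh h0)] := S_polya.
under eq_integral => mu _.
  rewrite /h /= (_ : (fun x => _) = (fun x : borel X =>
      F mu * (\1_(heavy_atoms B j mu) x)%:E)); last first.
    by apply/funext => x; rewrite muleC.
  have mA := measurable_heavy_atoms j mu mB.
  rewrite ge0_integralZl//; last exact/measurable_EFinP/measurable_indic.
  rewrite integral_indic// setIT muleC.
  over.
move=> ->; apply: eq_integral => mu _; congr (_ * _); apply: eq_integral => x _.
rewrite /h /= !indicE; congr (_%:R%:E * _); congr nat_of_bool.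
by apply/idP/idP; rewrite !inE => /heavy_atoms_add_dirac.
Qed.

Variable F' : PM -> \bar R.
Hypotheses (mF' : measurable_fun setT F') (F'0 : forall mu, 0 <= F' mu).

Lemma mecke_heavy_mass_le j :
  (forall mu x, B x -> F (pm_add mu (pm_dirac x)) <= F' mu) ->
  \int[S]_mu (G j mu * F mu) <=
  z%:E * \int[S]_mu (((fresh_mass j.-1)%:E + G j.-1 mu) * F' mu).
Proof.
move=> FF'; rewrite mecke_heavy_mass -ge0_integralZl//; last 2 first.
- by apply: emeasurable_funM => //; apply: emeasurable_funD.
- by move=> mu _; rewrite mule_ge0// adde_ge0 ?heavy_mass_ge0// lee_fin.
apply: ge0_le_integral_pointwise => mu.
  by rewrite mule_ge0 ?lee_fin// integral_ge0// => x _; rewrite mule_ge0 ?lee_fin.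
apply: lee_wpmul2l; first by rewrite lee_fin.
have mA := measurable_heavy_atoms j.-1 mu mB.
rewrite -added_mass_heavy_atoms muleC.
have -> : lf_add kappa mu (heavy_atoms B j.-1 mu) =
    \int[lf_add kappa mu]_x (\1_(heavy_atoms B j.-1 mu) x)%:E.
  by rewrite integral_indic// setIT.
rewrite -ge0_integralZl//; last exact/measurable_EFinP/measurable_indic.
apply: ge0_le_integral_pointwise => x; first by rewrite mule_ge0 ?lee_fin.
rewrite muleC; have [Ax|nAx] := pselect (heavy_atoms B j.-1 mu x).
  by rewrite indicE mem_set// !mule1; apply: FF'; case: Ax.
by rewrite indicE memNset// !mule0.
Qed.

End mecke.

Local Open Scope ereal_scope.

Local Notation g := (heavy_massR B).
Let gE j mu : G j mu = (g j mu)%:E.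
Proof. exact: heavy_massE. Qed.
Let g_ge0 j mu : (0 <= g j mu)%R. Proof. exact: heavy_massR_ge0. Qed.

Let S1 : S setT = 1. Proof. by case: S_polya. Qed.

Let int_cst (c : R) : \int[S]_mu c%:E = c%:E.
Proof. by rewrite integral_cst// S1 mule1. Qed.

Lemma integral_heavy_massS j : \int[S]_mu G j mu =
  z%:E * ((fresh_mass j.-1)%:E + \int[S]_mu G j.-1 mu).
Proof.
have := @mecke_heavy_mass (cst 1) (measurable_cst _) (fun=> lee01) j.
under eq_integral do rewrite mule1.
move=> ->.
under eq_integral => mu _.
  under eq_integral do rewrite mule1.
  rewrite integral_indic ?setIT//; last exact: measurable_heavy_atoms.
  rewrite added_mass_heavy_atoms; over.
rewrite ge0_integralZl//; last 2 first.
- exact: emeasurable_funD.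
- by move=> mu _; rewrite adde_ge0 ?heavy_mass_ge0// lee_fin.
rewrite ge0_integralD// ?int_cst//.
by move=> mu _; rewrite lee_fin.
Qed.

(** Truncation events for the finiteness of the moments: [G 0] is bounded there,
    and a configuration outside stays outside when a point is added. *)
Definition light (m : nat) : set PM := [set mu | G 0 mu <= m%:R%:E].

Let measurable_light m : measurable (light m).
Proof.
by rewrite -[X in measurable X]setTI; exact: emeasurable_fun_infty_c.
Qed.

Let mlight m : measurable_fun setT (fun mu : PM => (\1_(light m) mu : R)%:E).
Proof. exact/measurable_EFinP/measurable_indic. Qed.

Lemma integral_le_light (f : PM -> \bar R) (c : \bar R) :
  measurable_fun setT f -> (forall mu, 0 <= f mu) ->
  (forall m, \int[S]_mu (f mu * (\1_(light m) mu)%:E) <= c) ->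
  \int[S]_mu f mu <= c.
Proof.
move=> mf f0 fc.
pose h m mu := f mu * (\1_(light m) mu : R)%:E.
have limh mu : limn (h ^~ mu) = f mu.
  apply/cvg_lim => //; apply: cvg_near_cst; near=> m.
  rewrite /h indicE mem_set ?mule1// /light /= gE lee_fin.
  by near: m; exact: nbhs_infty_ger.
have mh m : measurable_fun setT (h m) by exact: emeasurable_funM.
have h0 m mu : setT mu -> 0 <= h m mu by rewrite mule_ge0// lee_fin.
have ndh mu : setT mu -> {homo h ^~ mu : m n / (m <= n)%N >-> m <= n}.
  move=> _ m n mn; apply: lee_wpmul2l => //; rewrite lee_fin.
  rewrite !indicE ler_nat; have [ml|] := boolP (mu \in light m) => //.
  rewrite mem_set//; move: ml; rewrite inE /light /= => /le_trans; apply.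
  by rewrite lee_fin ler_nat.
have := @cvg_monotone_convergence _ _ _ S setT measurableT h.
under [X in _ --> X]eq_integral do rewrite limh.
move=> /(_ mh h0 ndh) hcvg; rewrite -(cvg_lim _ hcvg)//; apply: lime_le.
  by apply/cvg_ex; eexists; exact: hcvg.
by apply: nearW => m; exact: fc.
Unshelve. all: by end_near. Qed.

Let light01 m mu : (\1_(light m) mu : R) = 0%R \/ (\1_(light m) mu : R) = 1%R.
Proof. by rewrite indicE; case: (_ \in _); [right|left]. Qed.

Let light_le1 m mu : ((\1_(light m) mu : R) <= 1)%R.
Proof. by case: (light01 m mu) => ->. Qed.

Let light_addl m mu (x : X) : B x ->
  ((\1_(light m) (pm_add mu (pm_dirac x)) : R) <= \1_(light m) mu)%R.
Proof.
move=> Bx; rewrite !indicE ler_nat.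
have [|] := boolP (pm_add mu (pm_dirac x) \in light m) => //.
rewrite inE /light /= heavy_mass0 pm_add_diracE => h.
rewrite mem_set//= heavy_mass0; apply: le_trans h.
by rewrite leeDl// lee_fin.
Qed.

Let int_light_fin (f : PM -> R) m (M : R) : measurable_fun setT f ->
  (forall mu, 0 <= f mu)%R -> (forall mu, light m mu -> f mu <= M)%R ->
  \int[S]_mu (f mu * \1_(light m) mu)%:E \is a fin_num.
Proof.
move=> mf f0 fM; rewrite ge0_fin_numE; last first.
  by apply: integral_ge0 => mu _; rewrite lee_fin mulr_ge0.
rewrite (@le_lt_trans _ _ (\int[S]_mu `|M|%:E))//; last by rewrite int_cst ltry.
apply: ge0_le_integral_pointwise => mu; rewrite lee_fin ?mulr_ge0//.
rewrite indicE; have [|_] := boolP (mu \in light m); rewrite ?mulr0//.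
by rewrite inE mulr1 => /fM/le_trans; apply; exact: ler_norm.
Qed.

Let mg j : measurable_fun setT (g j : PM -> R).
Proof. exact: measurable_heavy_massR. Qed.

Let z1 : (0 < 1 - z)%R. Proof. by rewrite subr_gt0. Qed.

Let g0_light m mu : light m mu -> (g 0 mu <= m%:R)%R.
Proof. by rewrite /light /= gE lee_fin. Qed.

(** On [light m] the expectation [I] of [G 0] is finite and satisfies
    [I <= z * (k + I)], which bounds it independently of [m]. *)
Lemma integral_heavy_mass0_le : \int[S]_mu G 0 mu <= (z * k / (1 - z))%:E.
Proof.
apply: integral_le_light => // m.
set I := \int[S]_mu _.
have IE : I = \int[S]_mu (g 0 mu * \1_(light m) mu)%:E.
  by apply: eq_integral => mu _; rewrite gE EFinM.
have If : I \is a fin_num.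
  by rewrite IE; apply: (@int_light_fin (g 0) m m%:R) => //; exact: g0_light.
have : I <= z%:E * (k%:E + I).
  have l0 mu : 0 <= (\1_(light m) mu : R)%:E by rewrite lee_fin.
  apply: (le_trans (@mecke_heavy_mass_le _ (mlight m) l0 _ (mlight m) l0 0 _)).
    by move=> mu x Bx; rewrite lee_fin light_addl.
  apply: lee_wpmul2l; first by rewrite lee_fin.
  apply: (@le_trans _ _ (\int[S]_mu (k%:E + (g 0 mu * \1_(light m) mu)%:E))).
    apply: ge0_le_integral_pointwise => mu; rewrite gE /= -EFinD -EFinM lee_fin.
      by rewrite mulr_ge0// addr_ge0.
    by rewrite mulrDl lerD2r ler_piMr.
  rewrite ge0_integralD//; last 2 first.
  - by move=> mu _; rewrite lee_fin mulr_ge0.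
  - by apply/measurable_EFinP; apply: measurable_funM => //; exact: measurable_indic.
  by rewrite int_cst IE.
rewrite -(fineK If) -EFinD -EFinM !lee_fin ler_pdivlMr//.
by move=> h; nra.
Qed.

(** [G 0] and [G 1] have the same mean, hence the exponent [j.-1.+1], which is
    [j] for positive [j]. *)
Definition mean_heavy_mass (j : nat) : R := (k * z ^+ j.-1.+1 / (1 - z))%R.

Let mean_heavy_mass_ge0 j : (0 <= mean_heavy_mass j)%R.
Proof. by rewrite /mean_heavy_mass divr_ge0 ?mulr_ge0 ?exprn_ge0// ltW. Qed.

Let mean_heavy_mass_le0 j : (mean_heavy_mass j <= mean_heavy_mass 0)%R.
Proof.
rewrite /mean_heavy_mass ler_pM2r ?invr_gt0// ler_wpM2l//= expr1 exprS.
by rewrite ler_piMr// exprn_ile1// ltW.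
Qed.

Lemma integral_heavy_mass j : \int[S]_mu G j mu = (mean_heavy_mass j)%:E.
Proof.
have E0 : \int[S]_mu G 0 mu = (mean_heavy_mass 0)%:E.
  have Ef : \int[S]_mu G 0 mu \is a fin_num.
    rewrite ge0_fin_numE; last by apply: integral_ge0 => mu _; exact: heavy_mass_ge0.
    exact: le_lt_trans integral_heavy_mass0_le (ltry _).
  have := integral_heavy_massS 0; rewrite /= -(fineK Ef) -EFinD -EFinM => -[h].
  congr EFin; rewrite /mean_heavy_mass /= expr1.
  apply: (mulIf (lt0r_neq0 z1)); rewrite divfK ?lt0r_neq0//.
  by rewrite mulrBr mulr1 {1}h; ring.
elim: j => // -[|j] ih; rewrite integral_heavy_massS/= ?E0 ?ih -EFinD -EFinM.
  congr EFin; rewrite /mean_heavy_mass/= expr1; field; exact: lt0r_neq0.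
by congr EFin; rewrite /mean_heavy_mass/= add0r [in RHS]exprS; ring.
Qed.

(** Same truncation as for the first moment: on [light m] the second moment [I]
    satisfies [I <= z * (I + c)]. *)
Lemma integral_heavy_mass_sqr_lty : \int[S]_mu (g 0 mu ^+ 2)%:E < +oo.
Proof.
pose c := ((k + 1) * mean_heavy_mass 0 + k)%R.
have c0 : (0 <= c)%R by rewrite addr_ge0// mulr_ge0// addr_ge0.
apply: (@le_lt_trans _ _ (z * c / (1 - z))%:E); last exact: ltry.
apply: integral_le_light => [|mu|m].
- by apply/measurable_EFinP; exact: measurable_funX.
- by rewrite lee_fin sqr_ge0.
set I := \int[S]_mu _.
have IE : I = \int[S]_mu (g 0 mu ^+ 2 * \1_(light m) mu)%:E.
  by apply: eq_integral => mu _; rewrite EFinM.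
have If : I \is a fin_num.
  rewrite IE; apply: (@int_light_fin _ m (m%:R ^+ 2)) => [|mu|mu /g0_light h].
  - exact: measurable_funX.
  - exact: sqr_ge0.
  - by rewrite ler_pXn2r// nnegrE.
have : I <= z%:E * (I + c%:E).
  pose F (mu : PM) := (g 0 mu * \1_(light m) mu)%:E.
  pose F' (mu : PM) := ((g 0 mu + 1) * \1_(light m) mu)%:E.
  have mF : measurable_fun setT F.
    by apply/measurable_EFinP; apply: measurable_funM => //; exact: measurable_indic.
  have mF' : measurable_fun setT F'.
    apply/measurable_EFinP; apply: measurable_funM; last exact: measurable_indic.
    exact: measurable_funD.
  have F0 mu : 0 <= F mu by rewrite lee_fin mulr_ge0.
  have F'0 mu : 0 <= F' mu by rewrite lee_fin mulr_ge0// addr_ge0.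
  rewrite [leLHS](_ : I = \int[S]_mu (G 0 mu * F mu)); last first.
    by apply: eq_integral => mu _; rewrite gE /F -!EFinM mulrA expr2.
  apply: (le_trans (@mecke_heavy_mass_le _ mF F0 _ mF' F'0 0 _)).
    move=> mu x Bx; rewrite lee_fin ler_pM// ?light_addl//.
    rewrite -lee_fin EFinD -!gE.
    exact: heavy_mass_add_dirac.
  apply: lee_wpmul2l; first by rewrite lee_fin.
  apply: (@le_trans _ _ (\int[S]_mu ((g 0 mu ^+ 2 * \1_(light m) mu)%:E +
      ((k + 1) * g 0 mu + k)%:E))).
    apply: ge0_le_integral_pointwise => mu; rewrite gE /= -?EFinD -EFinM lee_fin.
      by rewrite mulr_ge0 ?mulr_ge0// addr_ge0.
    have := k_ge0; have := g_ge0 0 mu; case: (light01 m mu) => ->; nra.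
  rewrite ge0_integralD//; last 4 first.
  - by move=> mu _; rewrite lee_fin mulr_ge0// sqr_ge0.
  - apply/measurable_EFinP; apply: measurable_funM; last exact: measurable_indic.
    exact: measurable_funX.
  - by move=> mu _; rewrite lee_fin addr_ge0// mulr_ge0// addr_ge0.
  - apply/measurable_EFinP; apply: measurable_funD => //.
    exact: measurable_funM.
  rewrite -IE; apply: leeD => //.
  under eq_integral do rewrite EFinD EFinM -gE.
  rewrite ge0_integralD//; last 2 first.
  - by move=> mu _; rewrite mule_ge0 ?heavy_mass_ge0// lee_fin addr_ge0.
  - exact: measurable_funeM.
  rewrite ge0_integralZl ?lee_fin ?addr_ge0//.
  by rewrite integral_heavy_mass int_cst.
rewrite -(fineK If) -EFinD -EFinM !lee_fin ler_pdivlMr//.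
by move=> h; nra.
Qed.


(** By induction on [i], each use of the integral equation trading one unit of
    [i] for a factor [z], with an error linear in [k]. For [i = j] the leading
    term is [mean_heavy_mass j ^+ 2], so that the variance is linear in [k]. *)
Lemma integral_heavy_massM i j :
  \int[S]_mu (g i mu * g j mu)%:E <=
  (z ^+ i.-1 * (z / (1 - z) * (k * mean_heavy_mass j + j.+1%:R * (k + mean_heavy_mass 0))) +
   i.-1%:R * (j.+1%:R * mean_heavy_mass 0))%:E.
Proof.
pose q i := \int[S]_mu (g i mu * g j mu)%:E.
have mgg i' : measurable_fun setT (fun mu : PM => (g i' mu * g j mu)%:E).
  by apply/measurable_EFinP; exact: measurable_funM.
have gg0 i' mu : 0 <= (g i' mu * g j mu)%:E by rewrite lee_fin mulr_ge0.
have g_le0 i' mu : (g i' mu <= g 0 mu)%R.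
  by rewrite -lee_fin -!gE [leRHS]heavy_mass0 heavy_mass_le.
have qf i' : q i' \is a fin_num.
  rewrite ge0_fin_numE; last exact: integral_ge0.
  apply: le_lt_trans integral_heavy_mass_sqr_lty.
  by apply: ge0_le_integral_pointwise => mu //; rewrite lee_fin expr2 ler_pM.
have step i' : (fine (q i') <= z * (fresh_mass i'.-1 * mean_heavy_mass j +
    fresh_mass i'.-1 * j.+1%:R + fine (q i'.-1) + j.+1%:R * mean_heavy_mass i'.-1))%R.
  rewrite -lee_fin fineK//.
  have -> : q i' = \int[S]_mu (G i' mu * G j mu).
    by apply: eq_integral => mu _; rewrite !gE -EFinM.
  have mF' : measurable_fun setT (fun mu : PM => G j mu + j.+1%:R%:E).
    exact: emeasurable_funD.
  have F'0 mu : 0 <= G j mu + j.+1%:R%:E.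
    by rewrite adde_ge0 ?heavy_mass_ge0// lee_fin.
  apply: (le_trans (@mecke_heavy_mass_le _ (mG j) (heavy_mass_ge0 B j) _ mF' F'0 i' _)).
    by move=> mu x Bx; exact: heavy_mass_add_dirac.
  rewrite EFinM; apply: lee_wpmul2l; first by rewrite lee_fin.
  rewrite (_ : (fun mu : PM => _) = (fun mu : PM =>
      (fresh_mass i'.-1)%:E * G j mu + ((fresh_mass i'.-1 * j.+1%:R)%:E +
      ((g i'.-1 mu * g j mu)%:E + j.+1%:R%:E * G i'.-1 mu)))); last first.
    apply/funext => mu; rewrite !gE !(=^~ EFinM, =^~ EFinD); congr EFin; ring.
  have mA : measurable_fun setT (fun mu : PM => j.+1%:R%:E * G i'.-1 mu).
    exact: measurable_funeM.
  have A0 mu : 0 <= j.+1%:R%:E * G i'.-1 mu.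
    by rewrite mule_ge0 ?heavy_mass_ge0// lee_fin.
  have mC : measurable_fun setT (fun mu : PM =>
      (g i'.-1 mu * g j mu)%:E + j.+1%:R%:E * G i'.-1 mu).
    exact: emeasurable_funD.
  have C0 mu : 0 <= (g i'.-1 mu * g j mu)%:E + j.+1%:R%:E * G i'.-1 mu.
    by rewrite adde_ge0.
  have f0 : 0 <= (fresh_mass i'.-1 * j.+1%:R)%:E by rewrite lee_fin mulr_ge0.
  rewrite ge0_integralD//; first last.
  - exact: emeasurable_funD.
  - by move=> mu _; rewrite adde_ge0.
  - exact: measurable_funeM.
  - by move=> mu _; rewrite mule_ge0 ?heavy_mass_ge0// lee_fin.
  rewrite ge0_integralD// int_cst ge0_integralD// !ge0_integralZl//; first last.
  - by rewrite lee_fin.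
  rewrite !integral_heavy_mass -/(q _) -(fineK (qf _)) -!EFinM -!EFinD lee_fin.
  by rewrite !addrA.
rewrite -/(q i) -(fineK (qf i)) lee_fin.
have j0 : (0 <= j.+1%:R :> R)%R by [].
have := j0; move: (j.+1%:R) step => c step {}j0.
set A := (z / (1 - z) * _)%R.
(* The equation for [q 0] involves [q 0] again; solving it yields [A]. *)
have q0 : (fine (q 0%N) <= A)%R.
  rewrite /A mulrAC ler_pdivlMr//.
  by have := step 0%N; rewrite /= => h; nra.
have AE : (A * (1 - z) = z * (k * mean_heavy_mass j + c * (k + mean_heavy_mass 0)))%R.
  by rewrite /A mulrAC divfK// lt0r_neq0.
case: i => [|i] /=; first by rewrite expr0 mul1r mul0r addr0.
elim: i => [|i ih] /=.
  rewrite expr0 mul1r mul0r addr0.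
  have : (z * fine (q 0%N) <= z * A)%R by rewrite ler_wpM2l.
  by have := step 1%N; rewrite /= => h1 h2; lra.
apply: (le_trans (step i.+2)); rewrite /= !mul0r !add0r exprS -natr1.
have := mean_heavy_mass_le0 i.+1.
have : (0 <= c * mean_heavy_mass 0)%R by rewrite mulr_ge0.
set a := (z ^+ i * A)%R in ih *.
rewrite -mulrA -/a.
have m0 := mean_heavy_mass_ge0 i.+1.
move=> cm mm.
have : (c * mean_heavy_mass i.+1 <= c * mean_heavy_mass 0)%R by rewrite ler_wpM2l.
have : (z * (c * mean_heavy_mass i.+1) <= c * mean_heavy_mass i.+1)%R.
  by apply: ler_piMl; [exact: mulr_ge0|exact: ltW].
have ic : (0 <= i%:R * (c * mean_heavy_mass 0))%R by rewrite mulr_ge0.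
have : (z * (i%:R * (c * mean_heavy_mass 0)) <= i%:R * (c * mean_heavy_mass 0))%R.
  by apply: ler_piMl; [exact: mulr_ge0|exact: ltW].
have : (z * fine (q i.+1) <= z * (a + i%:R * (c * mean_heavy_mass 0)))%R.
  by rewrite ler_wpM2l.
by move=> *; lra.
Qed.


Lemma heavy_mass_variance j :
  \int[S]_mu ((g j.+1 mu - mean_heavy_mass j.+1) ^+ 2)%:E <=
  ((j.+2%:R / (1 - z)) ^+ 2 * k)%:E.
Proof.
pose m := mean_heavy_mass j.+1.
have m_ge0 : (0 <= m)%R by exact: mean_heavy_mass_ge0.
have q_le := integral_heavy_massM j.+1 j.+1.
set q := \int[S]_mu _ in q_le *; set v := (X in X <= _).
have mv : measurable_fun setT (fun mu : PM => ((g j.+1 mu - m) ^+ 2)%:E).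
  apply/measurable_EFinP/measurable_funX; exact: measurable_funB.
(* The expansion of the square, arranged without differences of integrals. *)
have vE : v + (2 * m * m)%:E = q + (m ^+ 2)%:E.
  have m0 : (0 <= 2 * m)%R by rewrite mulr_ge0.
  rewrite [in LHS]EFinM -integral_heavy_mass -ge0_integralZl ?lee_fin//.
  rewrite -[(m ^+ 2)%:E]int_cst /v /q -!ge0_integralD//; first last.
  - exact: measurable_funeM.
  - by move=> mu _; rewrite mule_ge0 ?heavy_mass_ge0// lee_fin.
  - by move=> mu _; rewrite lee_fin sqr_ge0.
  - by move=> mu _; rewrite lee_fin sqr_ge0.
  - by apply/measurable_EFinP; exact: measurable_funM.
  - by move=> mu _; rewrite lee_fin mulr_ge0.
  apply: eq_integral => mu _; rewrite gE !(=^~ EFinM, =^~ EFinD); congr EFin.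
  by rewrite -/m; ring.
have v0 : 0 <= v by apply: integral_ge0 => mu _; rewrite lee_fin sqr_ge0.
have q0 : 0 <= q by apply: integral_ge0 => mu _; rewrite lee_fin mulr_ge0.
have qf : q \is a fin_num by rewrite ge0_fin_numE// (le_lt_trans q_le)// ltry.
have vf : v \is a fin_num.
  rewrite ge0_fin_numE// (@le_lt_trans _ _ (q + (m ^+ 2)%:E))//.
    by rewrite -vE leeDl// lee_fin; apply: mulr_ge0 => //; apply: mulr_ge0.
  by rewrite -(fineK qf) -EFinD ltry.
move: vE q_le; rewrite -(fineK vf) -(fineK qf) -!EFinD !lee_fin => -[vE] q_le.
suff : (fine q <= m ^+ 2 + (j.+2%:R / (1 - z)) ^+ 2 * k)%R by lra.
apply: (le_trans q_le) => /=.
have zj : (z ^+ j.+1 <= 1)%R by rewrite exprn_ile1// ltW.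
pose y := (1 - z)^-1%R; have y0 : (0 <= y)%R by rewrite invr_ge0 ltW.
have y1 : (1 <= y)%R by rewrite invf_ge1// lerBlDr lerDl.
have mE : m = (k * z ^+ j.+1 * y)%R by [].
have m0E : mean_heavy_mass 0 = (k * z * y)%R by rewrite /mean_heavy_mass/= expr1.
have km0 : (k + mean_heavy_mass 0 = k * y)%R.
  by rewrite m0E /y; field; exact: lt0r_neq0.
have m0y : (mean_heavy_mass 0 <= k * y)%R by rewrite -km0 lerDr.
rewrite km0 -/m -/y.
have -> : (z ^+ j * (z * y * (k * m + j.+2%:R * (k * y))) =
   m ^+ 2 + z ^+ j.+1 * (j.+2%:R * (k * y ^+ 2)))%R.
  rewrite mE !exprS; ring.
rewrite -addrA lerD2l.
have ky : (0 <= k * y ^+ 2)%R by rewrite mulr_ge0// sqr_ge0.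
have h1 : (z ^+ j.+1 * (j.+2%:R * (k * y ^+ 2)) <= j.+2%:R * (k * y ^+ 2))%R.
  by apply: ler_piMl => //; exact: mulr_ge0.
have h2 : (j%:R * (j.+2%:R * mean_heavy_mass 0) <= j%:R * (j.+2%:R * (k * y ^+ 2)))%R.
  rewrite ler_wpM2l// ler_wpM2l// (le_trans m0y)// ler_wpM2l// expr2.
  exact: ler_peMl.
apply: (le_trans (lerD h1 h2)).
have : (0 <= j.+2%:R * (k * y ^+ 2))%R by apply: mulr_ge0.
by rewrite -[j.+2]addn2 natrD exprMn; lra.
Qed.

End polya_sum_moments.

(** * Convergence along blocks of indices *)

(** Comparison with the telescoping sum of [n^-1 - n.+1^-1]. *)
Lemma sum_inv_sqr_le (R : realFieldType) n :
  \sum_(0 <= k < n) (k.+1%:R ^+ 2 : R)^-1 <= 2.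
Proof.
case: n => [|n]; first by rewrite big_nil.
suff : \sum_(0 <= k < n.+1) (k.+1%:R ^+ 2 : R)^-1 <= 2 - n.+1%:R^-1.
  by move=> h; apply: (le_trans h); rewrite lerBlDr lerDl invr_ge0.
elim: n => [|n ih]; first by rewrite big_nat1 expr1n invr1; lra.
rewrite big_nat_recr//=; apply: (le_trans (lerD ih (lexx _))).
have x0 : 0 < n.+1%:R :> R by [].
rewrite -[n.+2%:R]natr1; set x := n.+1%:R in x0 *.
have x1 : 0 < x + 1 by rewrite addr_gt0.
rewrite -subr_ge0 (_ : _ - _ = (x * (x + 1) ^+ 2)^-1).
  by rewrite invr_ge0 mulr_ge0 ?sqr_ge0// ltW.
by field; rewrite !lt0r_neq0.
Qed.

(** The sum of the squares has a finite integral, so it is almost surely finite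
    and its terms tend to 0. *)
Lemma cvg0_of_sqr_integrals d (T : measurableType d) (R : realType)
    (P : {measure set T -> \bar R}) (Z : nat -> T -> R) (c : R) :
  (forall k, measurable_fun setT (Z k)) ->
  (forall k, \int[P]_w (Z k w ^+ 2)%:E <= (c / k.+1%:R ^+ 2)%:E)%E ->
  {ae P, forall w, Z ^~ w @ \oo --> 0}.
Proof.
move=> mZ Zc.
pose f k w := (Z k w ^+ 2)%:E.
have f0 k w : (0 <= f k w)%E by rewrite lee_fin sqr_ge0.
have mf k : measurable_fun setT (f k).
  by apply/measurable_EFinP; exact: measurable_funX.
pose F w := (\sum_(k <oo) f k w)%E.
have mF : measurable_fun setT F.
  by apply: ge0_emeasurable_sum => // k w _ _; exact: f0.
have F0 w : (0 <= F w)%E by apply: nneseries_ge0 => k _ _; exact: f0.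
have Flty : (\int[P]_w F w < +oo)%E.
  rewrite integral_nneseries//.
  apply: (@le_lt_trans _ _ (`|c| * 2)%:E); last exact: ltry.
  apply: lime_le; first by apply: is_cvg_nneseries => k _ _; exact: integral_ge0.
  apply: nearW => n.
  apply: (@le_trans _ _ (\sum_(0 <= k < n) (`|c| * (k.+1%:R ^+ 2)^-1)%:E)%E).
    apply: lee_sum => k _; apply: (le_trans (Zc k)).
    by rewrite lee_fin ler_wpM2r ?invr_ge0 ?sqr_ge0// ler_norm.
  by rewrite sumEFin lee_fin -mulr_sumr ler_wpM2l// sum_inv_sqr_le.
have iF : P.-integrable setT F.
  apply/integrableP; split => //.
  by under eq_integral do rewrite gee0_abs//.
have := integrable_ae measurableT iF.
apply: filterS => w /(_ Logic.I) Fw.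
have fw : (\sum_(0 <= k < n) f k w)%E @[n --> \oo] --> (fine (F w))%:E.
  by rewrite fineK//; apply: is_cvg_nneseries => k _ _; exact: f0.
have sE : (fun n => \sum_(0 <= k < n) f k w)%E =
    EFin \o series (fun k => Z k w ^+ 2).
  by apply/funext => n; rewrite /f sumEFin.
move: fw; rewrite sE => /fine_cvgP[_ /cvgP/cvg_series_cvg_0 sqr0].
apply/cvgrPdist_lt => e e0.
have /cvgrPdist_lt /(_ _ (exprn_gt0 2 e0)) := sqr0.
apply: filterS => k; rewrite !sub0r !normrN ger0_norm ?sqr_ge0//.
by rewrite -[Z k w ^+ 2]real_normK ?num_real// ltr_sqr ?nnegrE// ltW.
Qed.

(** Threshold indices of a nondecreasing unbounded sequence [r]: [lo k] and
    [hi k] are the ends of the block of indices where [r] lies between [k.+1 ^ 2]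
    and [k.+2 ^ 2]. When that block is empty, [hi k] falls back on [lo k], so
    that [r (hi k)] is large in all cases. *)
Lemma square_blocks (R : realType) (r : R^nat) :
  {homo r : m n / (m <= n)%N >-> m <= n} -> r @ \oo --> +oo ->
  exists lo hi : nat -> nat,
    [/\ forall k, k.+1%:R ^+ 2 <= r (lo k), forall k, k.+1%:R ^+ 2 <= r (hi k) &
        forall k n, k.+1%:R ^+ 2 <= r n -> r n < k.+2%:R ^+ 2 ->
          [/\ (lo k <= n)%N, (n <= hi k)%N & r (hi k) < k.+2%:R ^+ 2]].
Proof.
move=> r_homo r_oo.
have ex k : exists n, k.+1%:R ^+ 2 <= r n.
  have /cvgryPge /(_ (k.+1%:R ^+ 2)) [n _ hn] := r_oo.
  by exists n; exact: hn (leqnn n).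
pose lo k := ex_minn (ex k).
have loP k : k.+1%:R ^+ 2 <= r (lo k) by rewrite /lo; case: ex_minnP.
have lo_min k n : k.+1%:R ^+ 2 <= r n -> (lo k <= n)%N.
  by rewrite /lo; case: ex_minnP => m _ + rn; apply.
pose hi k := maxn (lo k) (lo k.+1).-1.
exists lo, hi; split => // [k|k n rn_ge rn_lt].
  by apply: (le_trans (loP k)); apply: r_homo; exact: leq_maxl.
have nlo : (n < lo k.+1)%N.
  rewrite ltnNge; apply/negP => /r_homo /(le_trans (loP k.+1)).
  by rewrite leNgt rn_lt.
have lon := lo_min _ _ rn_ge.
have hiE : hi k = (lo k.+1).-1.
  by apply/maxn_idPr; rewrite -ltnS prednK ?(leq_ltn_trans lon)// (leq_ltn_trans _ nlo).
split => //; first by rewrite hiE -ltnS prednK// (leq_ltn_trans _ nlo).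
rewrite ltNge; apply/negP => /lo_min; rewrite hiE leqNgt prednK ?leqnn//.
by rewrite (leq_ltn_trans _ nlo).
Qed.

(** In the block [k] the ratio [N n / r n] lies between the ratios at [lo k] and
    [hi k], up to the factor [a k = (k.+1 / k.+2) ^+ 2], which tends to 1. *)
Lemma cvg_ratio_blocks (R : realType) (r N : R^nat) (lo hi : nat -> nat) (c : R) :
  (forall n, 0 < r n) -> r @ \oo --> +oo ->
  (forall n, 0 <= N n) -> {homo N : m n / (m <= n)%N >-> m <= n} ->
  (forall k, k.+1%:R ^+ 2 <= r (lo k)) ->
  (forall k n, k.+1%:R ^+ 2 <= r n -> r n < k.+2%:R ^+ 2 ->
          [/\ (lo k <= n)%N, (n <= hi k)%N & r (hi k) < k.+2%:R ^+ 2]) ->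
  N (lo k) / r (lo k) @[k --> \oo] --> c ->
  N (hi k) / r (hi k) @[k --> \oo] --> c ->
  N n / r n @[n --> \oo] --> c.
Proof.
move=> r0 r_oo N0 N_homo lo_ge block cvg_lo cvg_hi.
pose a k : R := k.+1%:R ^+ 2 / k.+2%:R ^+ 2.
have a_cvg : a @ \oo --> (1 : R).
  have h : (1 - k.+2%:R^-1 : R) @[k --> \oo] --> (1 - 0 : R).
    apply: cvgB; first exact: cvg_cst.
    by have := @cvg_harmonic R; rewrite -cvg_shiftS.
  have -> : a = (fun k => (1 - k.+2%:R^-1) * (1 - k.+2%:R^-1)).
    apply/funext => k; rewrite /a -expr_div_n expr2.
    suff -> : k.+1%:R / k.+2%:R = 1 - k.+2%:R^-1 :> R by [].
    apply/eqP; rewrite eq_sym subr_eq -[X in _ + X]mul1r -mulrDl natr1.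
    by rewrite divff// pnatr_eq0.
  by rewrite subr0 in h; rewrite -[X in _ --> X]mulr1; exact: cvgM.
have lo_cvg : N (lo k) / r (lo k) * a k @[k --> \oo] --> c.
  by rewrite -[c]mulr1; exact: cvgM.
have hi_cvg : N (hi k) / r (hi k) * (a k)^-1 @[k --> \oo] --> c.
  by rewrite -[c]mulr1 -[1]invr1; apply: cvgM => //; apply: cvgV => //; exact: oner_neq0.
apply/cvgrPdist_lt => e e0.
have /cvgrPdist_lt /(_ e e0) [K1 _ hK1] := lo_cvg.
have /cvgrPdist_lt /(_ e e0) [K2 _ hK2] := hi_cvg.
pose K := maxn K1 K2.
near=> n.
have rn : K.+1%:R ^+ 2 <= r n by near: n; move/cvgryPge : r_oo; exact.
(* The block of [n] is read off the integer part of the square root of [r n]. *)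
pose s := Num.sqrt (r n).
have s0 : 0 <= s := sqrtr_ge0 _.
have sE : s ^+ 2 = r n by rewrite sqr_sqrtr// ltW.
have Ks : K.+1%:R <= s by rewrite -ler_sqr ?nnegrE// sE.
have /andP[ms sm] := truncn_itv s0.
have Km : (K.+1 <= Num.truncn s)%N by rewrite truncn_ge_nat.
case: (Num.truncn s) Km ms sm => // k Kk ks sk.
have kn : k.+1%:R ^+ 2 <= r n by rewrite -sE ler_sqr ?nnegrE.
have nk : r n < k.+2%:R ^+ 2 by rewrite -sE ltr_sqr ?nnegrE.
have [lon nhi rhi] := block k n kn nk.
have {}hK1 := hK1 k (leq_trans (leq_maxl _ _) Kk).
have {}hK2 := hK2 k (leq_trans (leq_maxr _ _) Kk).
have sqr_gt0 m : (0 : R) < m.+1%:R ^+ 2 by rewrite exprn_gt0.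
have lower : N (lo k) / r (lo k) * a k <= N n / r n.
  rewrite ler_pdivlMr// -[X in X <= _]mulrA.
  apply: le_trans (N_homo _ _ lon).
  rewrite -[leRHS](divfK (lt0r_neq0 (r0 (lo k)))).
  rewrite ler_wpM2l ?divr_ge0 ?N0 ?(ltW (r0 _))//.
  apply: le_trans (lo_ge k).
  by rewrite /a mulrAC ler_pdivrMr// ler_wpM2l ?ltW.
have upper : N n / r n <= N (hi k) / r (hi k) * (a k)^-1.
  rewrite ler_pdivrMr// -[X in _ <= X]mulrA; apply: (le_trans (N_homo _ _ nhi)).
  rewrite -[leLHS](divfK (lt0r_neq0 (r0 (hi k)))).
  rewrite ler_wpM2l ?divr_ge0 ?N0 ?(ltW (r0 _))//.
  apply: (le_trans (ltW rhi)).
  by rewrite /a invf_div mulrAC ler_pdivlMr// ler_wpM2l// ltW.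
move: hK1 hK2; rewrite !ltr_distlC => /andP[lo1 _] /andP[_ hi2].
by rewrite (lt_le_trans lo1 lower) (le_lt_trans upper hi2).
Unshelve. all: by end_near. Qed.

(** * From rational times to all times, and from masses to occupation numbers *)

(** [t] is enclosed between two rationals at which [phi] is close to [phi t];
    there [f n] converges, and monotonicity encloses [f n t]. *)
Lemma cvg_monotone_rat (R : realType) (f : nat -> R -> R) (phi : R -> R) (t : R) :
  0 < t < 1 ->
  (forall n s u, 0 <= s -> s <= u -> u < 1 -> f n s <= f n u) ->
  (forall q : rat, 0 < (ratr q : R) < 1 ->
     f n (ratr q) @[n --> \oo] --> phi (ratr q)) ->
  {for t, continuous phi} ->
  f n t @[n --> \oo] --> phi t.
Proof.
move=> /andP[t0 t1] f_homo f_rat phi_t.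
apply/cvgrPdist_lt => e e0.
have e20 : 0 < e / 2 by rewrite divr_gt0.
have /cvgrPdist_lt /(_ _ e20) /nbhs_ballP[d /= d0 phi_d] := phi_t.
have near_rat (a b : R) : a < b -> 0 <= a -> b <= 1 -> t - d <= a -> b <= t + d ->
    exists q : rat, [/\ a < ratr q, ratr q < b, 0 < (ratr q : R) < 1 &
      `|phi t - phi (ratr q)| < e / 2].
  move=> ab a0 b1 da bd; have [q] := rat_in_itvoo ab.
  rewrite in_itv/= => /andP[aq qb]; exists q; split => //.
    by rewrite (le_lt_trans a0 aq) (lt_le_trans qb b1).
  apply: phi_d; rewrite /ball/= ltr_distlC.
  by rewrite (le_lt_trans da aq) (lt_le_trans qb bd).
have [|||||q1 [_ q1t q1I phi1]] := near_rat (Num.max 0 (t - d)) t.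
- by rewrite gt_max t0 ltrBlDr ltrDl.
- by rewrite le_max lexx.
- exact: ltW.
- by rewrite le_max lexx orbT.
- by rewrite lerDl ltW.
have [|||||q2 [tq2 _ q2I phi2]] := near_rat t (Num.min 1 (t + d)).
- by rewrite lt_min t1 ltrDl.
- exact: ltW.
- by rewrite ge_min lexx.
- by rewrite gerBl ltW.
- by rewrite ge_min lexx orbT.
have /cvgrPdist_lt /(_ _ e20) f1 := f_rat q1 q1I.
have /cvgrPdist_lt /(_ _ e20) f2 := f_rat q2 q2I.
case/andP: q1I => q10 _; case/andP: q2I => _ q21.
near=> n.
have g1 : `|phi (ratr q1) - f n (ratr q1)| < e / 2 by near: n; exact: f1.
have g2 : `|phi (ratr q2) - f n (ratr q2)| < e / 2 by near: n; exact: f2.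
have h1 := f_homo n _ _ (ltW q10) (ltW q1t) t1.
have h2 := f_homo n _ _ (ltW t0) (ltW tq2) q21.
move: phi1 phi2 g1 g2; rewrite !ltr_distl.
move=> /andP[? ?] /andP[? ?] /andP[? ?] /andP[? ?].
by apply/andP; split; lra.
Unshelve. all: by end_near. Qed.

Lemma weighted_measure_set1 (R : realType) (w : nat -> {nonneg R}) (j : nat) :
  weighted_measure w [set j.+1] = (w j.+1)%:num%:E.
Proof.
pose f k : \bar R := mscale (w k) \d_k [set j.+1].
have fE k : f k = ((w k)%:num%:E * (k == j.+1)%:R%:E)%E.
  rewrite (_ : f k = (w k)%:num%:E * \d_k [set j.+1])%E// diracE.
  by congr (_ * (nat_of_bool _)%:R%:E)%E; apply/idP/eqP => [/set_mem//|->]; exact/mem_set.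
rewrite [LHS](_ : _ = \sum_(1 <= k <oo) f k)%E//.
rewrite (nneseries_split _ j.+1) => [|k _]; last by rewrite fE mule_ge0// lee_fin.
rewrite eseries0 ?adde0 => [|k]; last first.
  by rewrite add1n => jk _; rewrite fE gtn_eqF// mule0.
rewrite add1n big_nat_recr//= big1_seq ?add0e => [|k /=]; last first.
  by rewrite mem_index_iota => /andP[_ kj]; rewrite fE ltn_eqF// mule0.
by rewrite fE eqxx mule1.
Qed.

Section occupation.
Context (R : realType) (X : polishType R).
Implicit Types (B : set (borel X)) (mu : pointmeasure X).

Lemma occupied_massE B mu (j : nat) : measurable B -> bounded_subset B ->
  j.+1%:R * #|` fset_set (occupied B mu j.+1)|%:R =
  heavy_massR B j.+1 mu - heavy_massR B j.+2 mu.
Proof.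
move=> mB bB; set O := occupied B mu j.+1.
have fO : finite_set O by exact: occupied_finite.
have int_atom (x : X) : exists n : nat, pm_measure mu [set x] = n%:R%:E.
  by apply: pm_integer; [exact: measurable_point|
    exists x, 1 => _ ->; exact: ballxx].
have mO : measurable (O : set (borel X)).
  apply: countable_measurable; first exact: measurable_point.
  exact: finite_set_countable.
have heavyE : heavy_atoms B j.+1 mu = O `|` heavy_atoms B j.+2 mu.
  apply/seteqP; split => x.
    move=> [Bx /=]; have [n xn] := int_atom x.
    rewrite /heavy_atoms /O /occupied /= xn !lee_fin !ler_nat leq_eqVlt.
    by move=> /predU1P[<-|nj]; [left|right].
  move=> [[Bx xj]|[Bx /= xj]]; split => //=; first by rewrite xj.
  by apply: le_trans xj; rewrite lee_fin ler_nat.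
have OI : O `&` heavy_atoms B j.+2 mu = set0.
  apply/seteqP; split => // x [[_ xj] [_ /=]].
  by rewrite xj lee_fin ler_nat ltnn.
have massO : pm_measure mu O = (j.+1%:R * #|` fset_set O|%:R)%:E.
  have OE : O = \big[setU/set0]_(x <- fset_set O) [set x].
    rewrite -bigcup_fset; apply/seteqP; split => [x Ox|x [y yO ->]].
      by exists x => //; rewrite /= in_fset_set// mem_set.
    by move: yO; rewrite /= in_fset_set// inE.
  rewrite {1}OE measure_fbigsetU//; last 2 first.
  - by move=> x _; exact: measurable_point.
  - by move=> x y _ _ [z [/= -> ->]].
  rewrite (eq_big_seq (fun=> j.+1%:R%:E)) => [|x]; last first.
    by rewrite in_fset_set// inE => -[].
  by rewrite sumEFin big_const_seq count_predT iter_addr_0 mulr_natr.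
have : heavy_mass B j.+1 mu =
    ((j.+1%:R * #|` fset_set O|%:R)%:E + heavy_mass B j.+2 mu)%E.
  rewrite /heavy_mass heavyE measureU//; first by congr (_ + _)%E; exact: massO.
  exact: measurable_heavy_atoms.
by rewrite !heavy_massE// -EFinD => -[->]; rewrite addrK.
Qed.
End occupation.

(** * The spatial Chinese restaurant process *)

Section chinese_restaurant.
Context (R : realType) (X : polishType R) (rho : lfmeasure X).
Local Notation PM := (borel (pointmeasure X)).
Context (d : measure_display) (Omega : measurableType d)
        (P : probability Omega R) (Y : R -> Omega -> PM).
Hypothesis Y_crp : spatial_crp P rho Y.

Lemma pm_add0 (mu : pointmeasure X) : pm_add (pm_zero X) mu = mu.
Proof.
apply: pointmeasure_eq; apply/funext => A.
by rewrite [LHS](measure_addE (lf_zero X) mu A) /= /mzero add0e.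
Qed.

Lemma pm_sub0 (mu : pointmeasure X) : pm_sub mu (pm_zero X) = mu.
Proof.
rewrite /pm_sub -[RHS]pm_add0.
have /getPex/= : exists e, [set e | pm_add (pm_zero X) e = mu] e.
  by exists mu; exact: pm_add0.
by rewrite pm_add0 => ->; rewrite pm_add0.
Qed.

(** The increment over [[0, t]], which starts from the zero configuration, is
    [Y t] itself. *)
Lemma crp_law (t : R) : 0 < t < 1 ->
  exists S : {measure set PM -> \bar R},
    polya_sum t (lf_add rho (pm_zero X)) S /\
    forall f : PM -> \bar R, measurable_fun setT f -> (forall mu, (0 <= f mu)%E) ->
      (\int[S]_mu f mu = \int[P]_w f (Y t w))%E.
Proof.
move=> /andP[t0 t1].
have [K [K_polya K_law]] := crp_increments Y_crp (lexx 0) t0 t1.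
exists (K (pm_zero X)); split.
  by have := K_polya (pm_zero X); rewrite !subr0 divr1.
have mY : measurable_fun setT (Y t).
  by apply: (crp_measurable Y_crp); rewrite (ltW t0).
have lawE A : measurable A -> K (pm_zero X) A = P (Y t @^-1` A).
  move=> mA; have := K_law A setT mA measurableT.
  rewrite preimage_setT setTI.
  rewrite (_ : (fun w => pm_sub (Y t w) (Y 0 w)) = Y t); last first.
    by apply/funext => w; rewrite (crp_start Y_crp) pm_sub0.
  move=> ->; rewrite (eq_integral (fun=> K (pm_zero X) A)); last first.
    by move=> w _; rewrite (crp_start Y_crp).
  by rewrite integral_cst// [X in (_ * X)%E]probability_setT mule1.
move=> f mf f0.
rewrite (@eq_measure_integral _ _ _ _ (pushforward P (Y t))).
  by rewrite ge0_integral_pushforward// preimage_setT.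
by move=> A mA _; exact: lawE.
Qed.

Variable B : nat -> set (borel X).
Hypothesis B_increasing : forall m n, (m <= n)%N -> B m `<=` B n.
Hypothesis B_measurable : forall n, measurable (B n).
Hypothesis B_bounded : forall n, bounded_subset (B n).
Hypothesis B_cover : \bigcup_n B n = setT.
Hypothesis rhoB_gt0 : forall n, (0 < rho (B n))%E.
Hypothesis rho_infinite : rho [set: borel X] = +oo%E.
Hypothesis rho_diffuse : forall x : X, rho [set x] = 0%E.

Let r n : R := fine (rho (B n)).

Let rE n : rho (B n) = (r n)%:E.
Proof. by rewrite fineK// ge0_fin_numE// lf_bounded_lty. Qed.

Let r_gt0 n : 0 < r n. Proof. by rewrite -lte_fin -rE. Qed.

Let r_homo : {homo r : m n / (m <= n)%N >-> m <= n}.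
Proof.
move=> m n mn; rewrite -lee_fin -!rE; apply: le_measure; rewrite ?inE//.
exact: B_increasing.
Qed.

Let r_oo : r @ \oo --> +oo.
Proof.
apply/cvgeryP.
under eq_fun do rewrite -rE.
rewrite -rho_infinite -B_cover; apply: nondecreasing_cvg_mu => //.
  by rewrite B_cover; exact: measurableT.
by move=> m n mn; apply/subsetPset; exact: B_increasing.
Qed.

(** The mean square deviation from the limit is at most [D / r n], which is
    summable along the ends of the blocks. *)
Lemma crp_heavy_massR_cvg (t : R) (j : nat) : 0 < t < 1 ->
  {ae P, forall w, heavy_massR (B n) j.+1 (Y t w) / fine (rho (B n))
    @[n --> \oo] --> t ^+ j.+1 / (1 - t)}.
Proof.
move=> t01; have [S [S_polya S_law]] := crp_law t01.
case/andP: t01 => t0 t1.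
pose kappa := lf_add rho (pm_zero X).
have kappaE A : kappa A = rho A.
  by rewrite [LHS](measure_addE rho (lf_zero X) A) /= /mzero adde0.
have kappa_diffuse (x : X) : kappa [set x] = 0%E by rewrite kappaE.
have mY : measurable_fun setT (Y t).
  by apply: (crp_measurable Y_crp); rewrite (ltW t0).
pose c := t ^+ j.+1 / (1 - t); pose D := (j.+2%:R / (1 - t)) ^+ 2.
pose Z n w := heavy_massR (B n) j.+1 (Y t w) / r n - c.
have mg n : measurable_fun setT (heavy_massR (B n) j.+1 : PM -> R).
  exact: measurable_heavy_massR.
have mZ n : measurable_fun setT (Z n).
  apply: measurable_funB => //; apply: measurable_funM => //.
  exact: measurableT_comp (mg n) mY.
have Z_sqr n : (\int[P]_w (Z n w ^+ 2)%:E <= (D / r n)%:E)%E.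
  have rn := lt0r_neq0 (r_gt0 n).
  pose f (mu : PM) := ((heavy_massR (B n) j.+1 mu - c * r n) ^+ 2)%:E.
  have mf : measurable_fun setT f.
    by apply/measurable_EFinP/measurable_funX; exact: measurable_funB.
  have f0 mu : (0 <= f mu)%E by rewrite lee_fin sqr_ge0.
  have ZE w : (Z n w ^+ 2)%:E = (((r n)^-1 ^+ 2)%:E * f (Y t w))%E.
    by rewrite -EFinM -exprMn; congr (_ ^+ 2)%:E; rewrite /Z; field.
  under eq_integral do rewrite ZE.
  rewrite ge0_integralZl//; last 2 first.
  - exact: measurableT_comp mf mY.
  - by rewrite lee_fin sqr_ge0.
  rewrite -S_law//.
  have := heavy_mass_variance (ltW t0) t1 kappa_diffuse S_polya
    (B_measurable n) (B_bounded n) j.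
  rewrite /mean_heavy_mass -/kappa kappaE -/(r n).
  rewrite (_ : r n * t ^+ j.+1 / (1 - t) = c * r n); last by rewrite /c; ring.
  move=> fD; apply: (le_trans (lee_wpmul2l _ fD)).
    by rewrite lee_fin sqr_ge0.
  rewrite -EFinM lee_fin le_eqVlt; apply/orP; left; apply/eqP.
  by rewrite /D; field; rewrite rn subr_eq0 gt_eqF.
have [lo [hi [lo_ge hi_ge blocks]]] := square_blocks r_homo r_oo.
have sub_cvg (s : nat -> nat) : (forall k, k.+1%:R ^+ 2 <= r (s k)) ->
    {ae P, forall w, heavy_massR (B (s k)) j.+1 (Y t w) / r (s k) @[k --> \oo] --> c}.
  move=> s_ge; have := @cvg0_of_sqr_integrals _ _ _ P (fun k => Z (s k)) D
    (fun k => mZ (s k)).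
  have Zc k : (\int[P]_w (Z (s k) w ^+ 2)%:E <= (D / k.+1%:R ^+ 2)%:E)%E.
    apply: (le_trans (Z_sqr (s k))); rewrite lee_fin ler_wpM2l ?sqr_ge0//.
    by rewrite lef_pV2 ?posrE// exprn_gt0.
  move=> /(_ Zc); apply: filterS => w /= Zw.
  have -> : (fun k => heavy_massR (B (s k)) j.+1 (Y t w) / r (s k)) =
      (fun k => Z (s k) w + c).
    by apply/funext => k; rewrite /Z subrK.
  by rewrite -[X in _ --> X]add0r; apply: cvgD => //; exact: cvg_cst.
have := sub_cvg _ lo_ge; apply: filterS2 (sub_cvg _ hi_ge) => w whi wlo.
apply: (cvg_ratio_blocks r_gt0 r_oo _ _ lo_ge blocks wlo whi).
  by move=> n; exact: heavy_massR_ge0.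
move=> m n mn; rewrite -lee_fin -!heavy_massE//.
by apply: heavy_mass_subset => //; exact: B_increasing.
Qed.

Lemma crp_heavy_massR_cvg_all_times : {ae P, forall w, forall (t : R) (j : nat),
  0 <= t < 1 ->
  heavy_massR (B n) j.+1 (Y t w) / fine (rho (B n)) @[n --> \oo] -->
  t ^+ j.+1 / (1 - t)}.
Proof.
have : {ae P, forall w, forall (q : rat) (j : nat), 0 < (ratr q : R) < 1 ->
    heavy_massR (B n) j.+1 (Y (ratr q) w) / r n @[n --> \oo] -->
    (ratr q : R) ^+ j.+1 / (1 - ratr q)}.
  have : {ae P, forall w, forall k : nat,
      let: (q, j) := odflt (0 : rat, 0%N) (choice.unpickle k) in
      0 < (ratr q : R) < 1 ->
      heavy_massR (B n) j.+1 (Y (ratr q) w) / r n @[n --> \oo] -->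
      (ratr q : R) ^+ j.+1 / (1 - ratr q)}.
    apply: ae_foralln => k; case: (odflt _ _) => q j.
    have [q01|nq01] := boolP (0 < (ratr q : R) < 1).
      by apply: filterS (crp_heavy_massR_cvg j q01) => w.
    by apply: aeW => w.
  apply: filterS => w h q j q01; have := h (choice.pickle (q, j)).
  by rewrite choice.pickleK /=; exact.
apply: filterS => w h t j /andP[]; rewrite le_eqVlt => /predU1P[<- _|t0 t1].
  rewrite expr0n mul0r; under eq_fun do rewrite (crp_start Y_crp).
  rewrite (_ : (fun n => _) = cst 0); first exact: cvg_cst.
  by apply/funext => n; rewrite mul0r.
have t01 : 0 < t < 1 by rewrite t0.
apply: (@cvg_monotone_rat _ (fun n u => heavy_massR (B n) j.+1 (Y u w) / r n)
  (fun u => u ^+ j.+1 / (1 - u))) => //.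
- move=> n s u s0 su u1; rewrite ler_pM2r ?invr_gt0//.
  rewrite -lee_fin -!heavy_massE//; apply: heavy_mass_homo => // A mA.
  exact: (crp_increasing Y_crp).
- by move=> q q01; exact: h.
- apply: cvgM; first exact: exprn_continuous.
  apply: cvgV; first by rewrite subr_eq0 gt_eqF.
  by apply: cvgB => //; exact: cvg_cst.
Qed.

End chinese_restaurant.

Theorem proposition5p3 (R : realType) (X : polishType R) (rho : lfmeasure X)
    (rho_infinite : rho [set: borel X] = +oo%E)
    (rho_diffuse : forall x : X, rho [set x] = 0%E)
    (d : measure_display) (Omega : measurableType d) (P : probability Omega R)
    (Y : R -> Omega -> borel (pointmeasure X)) (Y_crp : spatial_crp P rho Y)
    (B : nat -> set (borel X))
    (B_increasing : forall m n, (m <= n)%N -> B m `<=` B n)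
    (B_measurable : forall n, measurable (B n))
    (B_bounded : forall n, bounded_subset (B n))
    (B_cover : \bigcup_n B n = setT)
    (rhoB_gt0 : forall n, (0 < rho (B n))%E) :
  {ae P, forall w, forall t : {nonneg R}, t%:num < 1 ->
    vague_cvg_nat
      (fun n => normalized_occupation rho (B n) (Y t%:num w))
      (log_measure t)}.
Proof.
have := crp_heavy_massR_cvg_all_times Y_crp B_increasing B_measurable B_bounded
  B_cover rhoB_gt0 rho_infinite rho_diffuse.
apply: filterS => w heavy_cvg t t1 [//|j] _.
have t01 : 0 <= t%:num < 1 by apply/andP; split.
have diff_cvg := cvgB (heavy_cvg _ j t01) (heavy_cvg _ j.+1 t01).
have tj : t%:num ^+ j.+1 / j.+1%:R = j.+1%:R^-1 *
    (t%:num ^+ j.+1 / (1 - t%:num) - t%:num ^+ j.+2 / (1 - t%:num)).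
  have c0 : j.+1%:R != 0 :> R by [].
  have t10 : 1 - t%:num != 0 by rewrite subr_eq0 gt_eqF.
  rewrite [t%:num ^+ j.+2]exprS; move: (t%:num ^+ j.+1) j.+1%:R c0 => y c c0.
  by field; rewrite c0 t10.
rewrite weighted_measure_set1 /= tj.
have -> : (fun n => normalized_occupation rho (B n) (Y t%:num w) [set j.+1]) =
    EFin \o (fun n => j.+1%:R^-1 *
      (heavy_massR (B n) j.+1 (Y t%:num w) / fine (rho (B n)) -
       heavy_massR (B n) j.+2 (Y t%:num w) / fine (rho (B n)))).
  apply/funext => n /=.
  rewrite [LHS](_ : _ = ((fine (rho (B n)))^-1)%:E *
    occupation (B n) (Y t%:num w) [set j.+1])%E// weighted_measure_set1 /=.
  rewrite -EFinM -mulrBl -occupied_massE// !mulrA mulVf ?pnatr_eq0// mul1r.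
  by rewrite mulrC.
apply: cvg_EFin; first exact: nearW.
by apply: cvgM; [exact: cvg_cst|exact: diff_cvg].
Qed.
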